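(* Let $(\mathbb{N},d)$ be a uniformly locally finite metric space with property A and let $E$ be a Banach space with a $1$-unconditional symmetric basis $\mathcal{E}$. Then all ghost operators in the regular uniform Roe algebra $\mathrm{B}_u^r(d,\mathcal{E})$ are compact.
   Context: All Banach spaces are complex unless said otherwise, and ''basis'' means Schauder basis. For a basis $\mathcal{E}=(e_n)_n$ of $E$, $(e_n^* )_n$ denotes the biorthogonal functionals and $\mathcal{L}(E)$ the bounded operators on $E$. Given a metric $d$ on $\mathbb{N}$, $a\in\mathcal{L}(E)$ is a band operator (with respect to $\mathcal{E}$ and $d$) if there is $r>0$ such that $e_m^*(ae_n)=0$ whenever $d(n,m)>r$; $\mathrm{B}_u[d,\mathcal{E}]$ is the algebra of band operators. $\mathcal{E}$ is $1$-unconditional if $\|\sum_{n\le k}\alpha_ne_n\|\le\|\sum_{n\le k}\beta_ne_n\|$ for all $k$ and all scalars with $|\alpha_n|\le|\beta_n|$. $\mathcal{E}$ is symmetric if for every bijection $\pi:\mathbb{N}\to\mathbb{N}$ there is $\lambda\ge1$ with $\lambda^{-1}\|\sum_{n\le k}\alpha_ne_n\|\le\|\sum_{n\le k}\alpha_ne_{\pi(n)}\|\le\lambda\|\sum_{n\le k}\alpha_ne_n\|$ for all $k$ and all scalars. Regular operators: if $\mathcal{E}$ is $1$-unconditional, let $E_{\mathbb{R}}$ be the closed real span of $\mathcal{E}$, a Dedekind complete real Banach lattice under the coordinatewise order; $E$ is its lattice complexification. For $a\in\mathcal{L}(E)$ write $a(x)=a_r(x)+ia_c(x)$ for $x\in E_{\mathbb{R}}$,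 with $a_r,a_c\in\mathcal{L}(E_{\mathbb{R}})$. The operator $a$ is regular if each of $a_r,a_c$ is a difference of two positive linear maps on $E_{\mathbb{R}}$ (a linear map is positive if it maps vectors with nonnegative coordinates to such vectors). $\mathcal{L}(E)_r$ is the set of regular operators. For $a\in\mathcal{L}(E)_r$ let $|a|=\sup_{t\in[0,2\pi]}|\cos(t)a_r+\sin(t)a_c|$ (supremum in the Dedekind complete lattice of regular operators on $E_{\mathbb{R}}$) and $\|a\|_r=\||a|\|$. If $d$ is uniformly locally finite and $\mathcal{E}$ is $1$-unconditional, every band operator is regular, and the regular uniform Roe algebra $\mathrm{B}_u^r(d,\mathcal{E})$ is the $\|\cdot\|_r$-closure of $\mathrm{B}_u[d,\mathcal{E}]$ in $\mathcal{L}(E)_r$. An operator $a\in\mathcal{L}(E)$ is a ghost if for all $\varepsilon>0$ there is $n_0\in\mathbb{N}$ such that $|e_m^*(ae_n)|\le\varepsilon$ for all $n,m\ge n_0$. A metric $d$ on $\mathbb{N}$ is uniformly locally finite if $\sup_{x}|B_r(x)|<\infty$ for all $r>0$ ($B_r(x)$ the closed $r$-ball). A $d$-partition of unit is a sequence $(\varphi_n:\mathbb{N}\to[0,1])_{n\in\mathbb{N}}$ with $\sup_m|\{n:\varphi_n(m)\ne0\}|<\infty$, $\sup_n\mathrm{diam}(\mathrm{supp}(\varphi_n))<\infty$, and $\sum_n\varphi_n(m)^2=1$ for all $m$. It has $(r,\varepsilon)$-variation if $d(k,m)<r$ implies $\sum_n|\varphi_n(k)-\varphi_n(m)|^2<\varepsilon^2$.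 A uniformly locally finite $(\mathbb{N},d)$ has property A if for all $r,\varepsilon>0$ there is a $d$-partition of unit with $(r,\varepsilon)$-variation. *)

(* Defs.v *)
From HB Require Import structures.
From mathcomp Require Import all_boot all_order all_algebra.
From mathcomp Require Import complex.
From mathcomp Require Import all_classical all_reals all_analysis.

Set Implicit Arguments.
Unset Strict Implicit.
Unset Printing Implicit Defensive.

Import Order.TTheory GRing.Theory Num.Theory.
Import numFieldNormedType.Exports.

Local Open Scope classical_set_scope.
Local Open Scope ring_scope.
Local Open Scope complex_scope.
Local Open Scope card_scope.

Section Coarse.
Context {R : realType}.
Implicit Type d : nat -> nat -> R.

Definition is_metric d : Prop :=
  [/\ forall x y, 0 <= d x y,
      forall x y, d x y = 0 <-> x = y,
      forall x y, d x y = d y x &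
      forall x y z, d x z <= d x y + d y z].

Definition uniformly_locally_finite d : Prop :=
  forall r : R, 0 < r ->
    exists N : nat, forall x, [set y | d x y <= r] #<= `I_N.

Definition partition_of_unit d (phi : nat -> nat -> R) : Prop :=
  [/\ forall n m, 0 <= phi n m <= 1,
      exists N : nat, forall m, [set n | phi n m != 0] #<= `I_N,
      exists D : R, forall n k m, phi n k != 0 -> phi n m != 0 -> d k m <= D &
      forall m, (\sum_(0 <= n <oo) (phi n m ^+ 2)%:E = 1%:E)%E].

Definition has_variation d (phi : nat -> nat -> R) (r eps : R) : Prop :=
  forall k m, d k m < r ->
    (\sum_(0 <= n <oo) (`|phi n k - phi n m| ^+ 2)%:E < (eps ^+ 2)%:E)%E.

Definition property_A d : Prop :=
  forall r eps : R, 0 < r -> 0 < eps ->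
    exists phi, partition_of_unit d phi /\ has_variation d phi r eps.

End Coarse.

Section Basis.
Context {R : realType} {E : completeNormedModType R[i]}.
Variable e : nat -> E.

Definition schauder_basis : Prop :=
  forall x : E, exists! c : nat -> R[i],
    series (fun n => c n *: e n) @ \oo --> x.

(* The biorthogonal functional e_n^*; for a Schauder basis the set below is a
   singleton. *)
Definition coord (n : nat) (x : E) : R[i] :=
  xget 0 [set z | exists2 c : nat -> R[i],
                    series (fun k => c k *: e k) @ \oo --> x & z = c n].

Definition one_unconditional : Prop :=
  forall (k : nat) (al be : nat -> R[i]),
    (forall n, (n < k)%N -> `|al n| <= `|be n|) ->
    `|\sum_(0 <= n < k) al n *: e n| <= `|\sum_(0 <= n < k) be n *: e n|.

Definition symmetric_basis : Prop :=
  forall sigma : nat -> nat, bijective sigma ->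
    exists2 lam : R, 1 <= lam &
      forall (k : nat) (al : nat -> R[i]),
        lam^-1%:C * `|\sum_(0 <= n < k) al n *: e n|
          <= `|\sum_(0 <= n < k) al n *: e (sigma n)|
          <= lam%:C * `|\sum_(0 <= n < k) al n *: e n|.

Definition real_part : set E :=
  closure [set x | exists (k : nat) (c : nat -> R),
                     x = \sum_(0 <= n < k) (c n)%:C *: e n].

(* In [R[i]], [0 <= z] means that z is real and nonnegative. *)
Definition positive_cone : set E :=
  [set x | real_part x /\ forall n, 0 <= coord n x].

(* An operator on the real space [real_part] is encoded as a function E -> E of
   which only the values on [real_part] matter: every notion below is
   insensitive to the other values. *)

Definition real_linear (f : E -> E) : Prop :=
  (forall x, real_part x -> real_part (f x)) /\
  (forall (c : R) x y, real_part x -> real_part y ->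
     f (c%:C *: x + y) = c%:C *: f x + f y).

Definition positive_op (f : E -> E) : Prop :=
  real_linear f /\ forall x, positive_cone x -> positive_cone (f x).

Definition regular_real_op (f : E -> E) : Prop :=
  exists p q : E -> E, [/\ positive_op p, positive_op q &
    forall x, real_part x -> f x = p x - q x].

Definition op_le (f g : E -> E) : Prop := positive_op (g \- f).

Definition is_op_sup (F : set (E -> E)) (s : E -> E) : Prop :=
  [/\ regular_real_op s,
      forall f, F f -> op_le f s &
      forall g, regular_real_op g -> (forall f, F f -> op_le f g) ->
        op_le s g].

Definition op_sup (F : set (E -> E)) : E -> E :=
  xget (fun=> 0) [set s | is_op_sup F s].

Definition real_abs (f : E -> E) : E -> E := op_sup [set f; \- f].

(* Each x in E is uniquely y + i z with y and z in [real_part]. *)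
Definition vec_re (x : E) : E :=
  get [set y | real_part y /\ exists2 z, real_part z & x = y + 'i%C *: z].

Definition vec_im (x : E) : E :=
  get [set z | real_part z /\ exists2 y, real_part y & x = y + 'i%C *: z].

Definition op_re (a : E -> E) : E -> E := vec_re \o a.
Definition op_im (a : E -> E) : E -> E := vec_im \o a.

Definition regular_op (a : E -> E) : Prop :=
  regular_real_op (op_re a) /\ regular_real_op (op_im a).

Definition op_modulus (a : E -> E) : E -> E :=
  op_sup [set real_abs (fun x => (cos t)%:C *: op_re a x
                                 + (sin t)%:C *: op_im a x)
         | t in [set t : R | 0 <= t <= 2 * pi]].

(* Norms of vectors take values in [R[i]]; [complex.Re] retracts them to R. *)
Definition real_opnorm (f : E -> E) : \bar R :=
  ereal_sup [set (complex.Re `|f x|)%:E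
            | x in [set x | real_part x /\ `|x| <= 1]].

Definition regular_norm (a : E -> E) : \bar R := real_opnorm (op_modulus a).

Definition band_op (d : nat -> nat -> R) (a : E -> E) : Prop :=
  exists2 r : R, 0 < r & forall n m, r < d n m -> coord m (a (e n)) = 0.

Definition regular_roe (d : nat -> nat -> R) (a : {linear E -> E}) : Prop :=
  [/\ continuous a, regular_op a &
      forall eps : R, 0 < eps -> exists b : {linear E -> E},
        [/\ continuous b, band_op d b &
            (regular_norm (a \- b)%R < eps%:E)%E]].

Definition ghost (a : E -> E) : Prop :=
  forall eps : R, 0 < eps -> exists n0 : nat, forall n m,
    (n0 <= n)%N -> (n0 <= m)%N -> `|coord m (a (e n))| <= eps%:C.

End Basis.

Definition compact_op {R : realType} {E : completeNormedModType R[i]}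
    (a : E -> E) : Prop :=
  precompact (a @` [set x | `|x| <= 1]).

(* Main.v *)
(* Property A provides a kernel [K] with values in [0, 1], supported on a band,
   with [1 - K] uniformly small on any prescribed band.  Let [b] be a band
   operator close to the ghost [a] in the regular norm, and write entrywise
     a = (1 - K) (a - b) + (1 - K) b + K a.
   The first term is dominated by the modulus of [a - b], whose norm is small;
   this is where the regular norm is used.  The second is a band matrix with
   small entries.  Since [a] is a ghost, so is the third after its first rows
   are discarded.  A properly coloured graph splits a band into finitely many
   matchings, i.e. involutions of the indices, on which the symmetry of the
   basis acts boundedly; a band matrix with small entries is therefore
   dominated by a small multiple of a fixed bounded positive operator.  Hence
   the tails of [a x] are uniformly small on the unit ball, which gives
   compactness. *)
From mathcomp Require Import all_boot all_order all_algebra.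
From mathcomp Require Import complex.
From mathcomp Require Import all_classical all_reals all_analysis.
From mathcomp Require Import ring lra.
Require Import Defs.

Set Implicit Arguments.
Unset Strict Implicit.
Unset Printing Implicit Defensive.

Import Order.TTheory GRing.Theory Num.Theory.
Import numFieldNormedType.Exports.

Local Open Scope classical_set_scope.
Local Open Scope ring_scope.
Local Open Scope complex_scope.
Local Open Scope card_scope.

(** * Real-valued norms *)

Section RealNorm.
Context {R : realType}.

(** Vector norms live in [R[i]]. Their real parts carry the same information and allow real order,
    real limits and linear arithmetic. *)
Definition nrm {V : normedZmodType R[i]} (x : V) : R := complex.Re `|x|.

Section Zmod.
Context {V : normedZmodType R[i]}.
Implicit Types x y : V.

Lemma nrmE x : `|x| = (nrm x)%:C.
Proof. by rewrite /nrm RRe_real. Qed.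

Lemma nrm_ge0 x : 0 <= nrm x.
Proof. by have := normr_ge0 x; rewrite nrmE lecR. Qed.

Lemma ler_nrmE x (c : R) : (`|x| <= c%:C) = (nrm x <= c).
Proof. by rewrite nrmE lecR. Qed.

Lemma nrmD x y : nrm (x + y) <= nrm x + nrm y.
Proof. by rewrite -lecR rmorphD /= -!nrmE ler_normD. Qed.

Lemma nrmN x : nrm (- x) = nrm x.
Proof. by rewrite /nrm normrN. Qed.

Lemma nrmB x y : nrm (x - y) <= nrm x + nrm y.
Proof. by rewrite -(nrmN y) nrmD. Qed.

Lemma nrm_distC x y : nrm (x - y) = nrm (y - x).
Proof. by rewrite -nrmN opprB. Qed.

Lemma nrm0 : nrm (0 : V) = 0.
Proof. by rewrite /nrm normr0. Qed.

Lemma nrm_eq0 x : nrm x = 0 -> x = 0.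
Proof. by move=> h; apply/eqP; rewrite -normr_eq0 nrmE h. Qed.

Lemma nrm_sum (I : Type) (r : seq I) (P : pred I) (F : I -> V) :
  nrm (\sum_(i <- r | P i) F i) <= \sum_(i <- r | P i) nrm (F i).
Proof.
elim/big_rec2: _ => [|i y x _ h]; first by rewrite nrm0.
by apply: le_trans (nrmD _ _) _; rewrite lerD2l.
Qed.

Lemma ler_nrm_dist x y : nrm x - nrm y <= nrm (x - y).
Proof. by rewrite lerBlDr -{1}(subrK y x) nrmD. Qed.

End Zmod.

Lemma nrmZ (V : normedModType R[i]) (c : R[i]) (x : V) :
  nrm (c *: x) = nrm c * nrm x.
Proof. by rewrite {1}/nrm normrZ !nrmE -rmorphM. Qed.

Lemma nrmM (c d : R[i]) : nrm (c * d) = nrm c * nrm d.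
Proof. by rewrite {1}/nrm normrM !nrmE -rmorphM. Qed.

Lemma nrmR (r : R) : nrm (r%:C : R[i]) = `|r|.
Proof. by rewrite /nrm normc_def /= expr0n addr0 sqrtr_sqr. Qed.

Lemma ReM_R (r : R) (z : R[i]) : complex.Re (r%:C * z) = r * complex.Re z.
Proof. by case: z => a b /=; rewrite mul0r subr0. Qed.

Lemma ImM_R (r : R) (z : R[i]) : complex.Im (r%:C * z) = r * complex.Im z.
Proof. by case: z => a b /=; rewrite mul0r addr0. Qed.

Lemma Re_le_nrm (z : R[i]) : `|complex.Re z| <= nrm z.
Proof.
rewrite /nrm normc_def /= -sqrtr_sqr ler_sqrt ?lerDl ?sqr_ge0 //.
by rewrite addr_ge0 ?sqr_ge0.
Qed.

Lemma Im_le_nrm (z : R[i]) : `|complex.Im z| <= nrm z.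
Proof.
rewrite /nrm normc_def /= -sqrtr_sqr ler_sqrt ?lerDr ?sqr_ge0 //.
by rewrite addr_ge0 ?sqr_ge0.
Qed.

Lemma nrm_le_ReIm (z : R[i]) : nrm z <= `|complex.Re z| + `|complex.Im z|.
Proof.
rewrite /nrm normc_def /= -[leRHS]ger0_norm ?addr_ge0 // -sqrtr_sqr.
rewrite ler_sqrt ?sqr_ge0 // sqrrD !real_normK ?num_real //.
by rewrite addrAC lerDl mulrn_wge0 // mulr_ge0.
Qed.

Lemma complex_RE (z : R[i]) : complex.Im z = 0 -> z = (complex.Re z)%:C.
Proof. by case: z => a b /= ->. Qed.

Lemma ge0_complexP (z : R[i]) :
  reflect (complex.Im z = 0 /\ 0 <= complex.Re z) (0 <= z).
Proof.
by case: z => a b; rewrite lecE /=; apply: (iffP andP) => [[/eqP]|[->]].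
Qed.

Section Limits.
Context {V : normedModType R[i]}.

Lemma cvg_nrmP (T : Type) (F : set_system T) {FF : Filter F} (u : T -> V) (x : V) :
  u @ F --> x <-> forall eps : R, 0 < eps -> \forall t \near F, nrm (x - u t) < eps.
Proof.
split => [/cvgrPdist_lt h eps e0|h].
  have := h eps%:C; rewrite ltcR => /(_ e0); apply: filterS => t.
  by rewrite nrmE ltcR.
apply/cvgrPdist_lt => eps e0.
have /complex_RE eE : complex.Im eps = 0 by have /ge0_complexP[] := ltW e0.
have e1 : 0 < complex.Re eps by rewrite -ltcR -eE.
by apply: filterS (h _ e1) => t; rewrite nrmE {2}eE ltcR.
Qed.

Lemma cvg_nrm (T : Type) (F : set_system T) {FF : Filter F} (u : T -> V) (x : V) :
  u @ F --> x -> (fun t => nrm (u t)) @ F --> nrm x.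
Proof.
move=> /cvg_nrmP h; apply/cvgrPdist_lt => eps /h; apply: filterS => t.
apply: le_lt_trans; rewrite ler_norml ler_nrm_dist andbT.
by rewrite lerNl opprB nrm_distC ler_nrm_dist.
Qed.

Lemma cvg_unique_nrm (u : nat -> V) (x y : V) :
  u @ \oo --> x -> u @ \oo --> y -> x = y.
Proof. by move=> h1 h2; apply: (cvg_unique (@norm_hausdorff _ V) h1 h2). Qed.

End Limits.

(** The increments of [u] are controlled by those of a convergent sequence, so [u] is Cauchy and
    completeness supplies a limit. *)
Lemma cvgn_dominated (V : completeNormedModType R[i]) (u v : nat -> V) (C : R) :
  cvgn v -> (forall k l, (l <= k)%N -> nrm (u k - u l) <= C * nrm (v k - v l)) -> cvgn u.
Proof.
move=> /cvg_ex[y /= /cvg_nrmP vy] huv; apply: cauchy_cvg; apply/cauchyP => eps e0.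
have /complex_RE eE : complex.Im eps = 0 by have /ge0_complexP[] := ltW e0.
have C0 : 0 < `|C| + 1 by rewrite ltr_pwDr.
(* Halved because [v k] and [v N] are compared through [y]; [|C| + 1] is a positive divisor whatever
   the sign of [C]. *)
have e1 : 0 < complex.Re eps / (`|C| + 1) / 2 by rewrite !divr_gt0 // -ltcR -eE.
have [N _ hN] := vy _ e1.
exists (u N); exists N => // k /= Nk; rewrite -ball_normE /= nrmE eE ltcR.
rewrite nrm_distC; apply: le_lt_trans (huv _ _ Nk) _.
have h : nrm (v k - v N) < complex.Re eps / (`|C| + 1).
  rewrite [ltRHS]splitr; have -> : v k - v N = (y - v N) - (y - v k).
    by rewrite opprB [RHS]addrC addrA subrK.
  by apply: le_lt_trans (nrmB _ _) _; apply: ltrD; apply: hN => /=.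
move: h; rewrite ltr_pdivlMr // mulrC; apply: le_lt_trans; rewrite ler_wpM2r ?nrm_ge0 //.
by rewrite (le_trans (ler_norm _)) // lerDl.
Qed.

Lemma lipschitz_cvg (V : normedModType R[i]) (f : V -> R) (C : R) (u : nat -> V) x :
  (forall y z, `|f y - f z| <= C * nrm (y - z)) ->
  u @ \oo --> x -> (f \o u) @ \oo --> f x.
Proof.
move=> hf /cvg_nrmP h; apply/cvgrPdist_lt => eps e0.
have C0 : 0 < `|C| + 1 by rewrite ltr_pwDr.
have := h (eps / (`|C| + 1)); rewrite divr_gt0 // => /(_ isT); apply: filterS => t.
rewrite ltr_pdivlMr // => {}h; apply: le_lt_trans (hf _ _) _.
apply: le_lt_trans h; rewrite mulrC ler_wpM2l ?nrm_ge0 //.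
by rewrite (le_trans (ler_norm _)) // lerDl.
Qed.

End RealNorm.

(** * Unconditional bases *)

Section Sequences.
Context {R : realType}.
Implicit Type u v : nat -> R.

Lemma ler_cvg_from u (l c : R) (N : nat) :
  u @ \oo --> l -> (forall n, (N <= n)%N -> c <= u n) -> c <= l.
Proof.
move=> ul h; have ul' : cvgn u by apply/cvg_ex; exists l.
rewrite -(cvg_lim _ ul) //; apply: limr_ge => //.
by exists N => // n /= /h.
Qed.

Lemma ger_cvg_from u (l c : R) (N : nat) :
  u @ \oo --> l -> (forall n, (N <= n)%N -> u n <= c) -> l <= c.
Proof.
move=> ul h; have ul' : cvgn u by apply/cvg_ex; exists l.
rewrite -(cvg_lim _ ul) //; apply: limr_le => //.
by exists N => // n /= /h.
Qed.

Lemma ler_cvg2 u v (l m : R) :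
  u @ \oo --> l -> v @ \oo --> m -> (forall n, u n <= v n) -> l <= m.
Proof.
move=> ul vm h; rewrite -subr_ge0; apply: (@ler_cvg_from _ _ _ 0 (cvgB vm ul)).
by move=> n _; rewrite subr_ge0.
Qed.

End Sequences.

Section Basis.
Context {R : realType} {E : completeNormedModType R[i]}.
Variable e : nat -> E.
Hypothesis he : schauder_basis e.

(** Uniqueness of expansions makes the choice in [coord] harmless: any convergent expansion reads
    off the coordinates. *)
Lemma coord_unique (c : nat -> R[i]) x :
  series (fun n => c n *: e n) @ \oo --> x -> forall n, coord e n x = c n.
Proof.
move=> h n; rewrite /coord; case: xgetP => [z _ [c' hc' ->]|/(_ (c n))]; last first.
  by case; exists c.
by have [d [_ du]] := he x; rewrite -(du _ h) -(du _ hc').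
Qed.

Definition proj (k : nat) (x : E) : E := \sum_(0 <= n < k) coord e n x *: e n.

Lemma proj_cvg x : proj^~ x @ \oo --> x.
Proof.
have [c [hc _]] := he x.
suff -> : proj^~ x = series (fun n => c n *: e n) by [].
apply/funext => k; rewrite /series /= /proj; apply: eq_bigr => n _.
by rewrite (coord_unique hc).
Qed.

Lemma coord_linear n a x y :
  coord e n (a *: x + y) = a * coord e n x + coord e n y.
Proof.
apply: (@coord_unique (fun n => a * coord e n x + coord e n y)).
have -> : series (fun n => (a * coord e n x + coord e n y) *: e n)
    = (fun k => a *: proj k x + proj k y).
  apply/funext => k; rewrite /series /= /proj scaler_sumr -big_split /=.
  by apply: eq_bigr => m _; rewrite scalerA scalerDl.
exact: cvgD (cvgZl_tmp (k := a) (@proj_cvg x)) (@proj_cvg y).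
Qed.

Lemma coord0 n : coord e n 0 = 0.
Proof. by have := coord_linear n (-1) 0 0; rewrite scaler0 addr0 mulN1r addNr. Qed.

Lemma coordD n x y : coord e n (x + y) = coord e n x + coord e n y.
Proof. by have := coord_linear n 1 x y; rewrite scale1r mul1r. Qed.

Lemma coordZ n a x : coord e n (a *: x) = a * coord e n x.
Proof. by have := coord_linear n a x 0; rewrite addr0 coord0 addr0. Qed.

Lemma coordN n x : coord e n (- x) = - coord e n x.
Proof. by rewrite -scaleN1r coordZ mulN1r. Qed.

Lemma coordB n x y : coord e n (x - y) = coord e n x - coord e n y.
Proof. by rewrite coordD coordN. Qed.

Lemma coord_sum n (I : Type) (r : seq I) (P : pred I) (F : I -> E) :
  coord e n (\sum_(i <- r | P i) F i) = \sum_(i <- r | P i) coord e n (F i).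
Proof. by elim/big_rec2: _ => [|i y x _ <-]; rewrite ?coord0 ?coordD. Qed.

Lemma sum_pick (V : zmodType) (k m : nat) (F : nat -> V) :
  \sum_(0 <= j < k) (if j == m then F j else 0) = if (m < k)%N then F m else 0.
Proof.
rewrite -big_mkcond /=; case: ifPn => [mk|]; last first.
  rewrite -leqNgt => km; rewrite big_nat_cond big1 // => j /andP[/andP[_ jk] /eqP jm].
  by move: jk; rewrite jm ltnNge km.
by rewrite big_nat1_eq mk.
Qed.

Lemma coord_basis n m : coord e n (e m) = (n == m)%:R.
Proof.
apply: (@coord_unique (fun n => (n == m)%:R)); apply/cvg_nrmP => eps e0.
exists m.+1 => // k /= mk; rewrite /series /=.
rewrite (eq_bigr (fun j => if j == m then e j else 0)) => [|j _].
  by rewrite sum_pick mk subrr nrm0.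
by case: eqP; rewrite ?scale1r ?scale0r.
Qed.

Lemma coord_fsum n k (c : nat -> R[i]) :
  coord e n (\sum_(0 <= j < k) c j *: e j) = if (n < k)%N then c n else 0.
Proof.
rewrite coord_sum -(sum_pick k n c); apply: eq_bigr => j _.
by rewrite coordZ coord_basis eq_sym; case: eqP; rewrite ?mulr1 ?mulr0.
Qed.

Lemma coord_proj n k x : coord e n (proj k x) = if (n < k)%N then coord e n x else 0.
Proof. exact: coord_fsum. Qed.

Lemma coord_inj x y : (forall n, coord e n x = coord e n y) -> x = y.
Proof.
move=> h; apply: (@cvg_unique_nrm R E (proj^~ x) x y); first exact: proj_cvg.
suff -> : proj^~ x = proj^~ y by exact: proj_cvg.
by apply/funext => k; apply: eq_bigr => n _; rewrite h.
Qed.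

Lemma proj_linear k a x y : proj k (a *: x + y) = a *: proj k x + proj k y.
Proof.
apply: coord_inj => n; rewrite coord_proj !coord_linear !coord_proj.
by case: ifP => // _; rewrite mulr0 addr0.
Qed.

Lemma basis_neq0 n : nrm (e n) != 0.
Proof.
apply/eqP => /nrm_eq0 h; have := coord_basis n n; rewrite h coord0 eqxx.
by move/eqP; rewrite eq_sym oner_eq0.
Qed.

Lemma basis_gt0 n : 0 < nrm (e n).
Proof. by rewrite lt_neqAle nrm_ge0 eq_sym basis_neq0. Qed.

(** * Consequences of unconditionality: monotone norm, continuous coordinates, solidness *)

Hypothesis hu : one_unconditional e.

Lemma nrm_fsum_le k (al be : nat -> R[i]) :
  (forall n, (n < k)%N -> nrm (al n) <= nrm (be n)) ->
  nrm (\sum_(0 <= n < k) al n *: e n) <= nrm (\sum_(0 <= n < k) be n *: e n).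
Proof.
by move=> h; rewrite -lecR -!nrmE; apply: hu => n /h; rewrite !nrmE lecR.
Qed.

Lemma nrm_proj_le k x : nrm (proj k x) <= nrm x.
Proof.
apply: (@ler_cvg_from _ (fun l => nrm (proj l x)) _ _ k).
  exact: cvg_nrm (@proj_cvg x).
(* Padding with zeros gives both sums the same length [l], as unconditionality requires. *)
move=> l kl; have -> : proj k x =
    \sum_(0 <= n < l) (if (n < k)%N then coord e n x else 0) *: e n.
  apply: coord_inj => n; rewrite coord_proj coord_fsum.
  by case: ifP => [nk|]; [rewrite (leq_trans nk kl)|rewrite if_same].
by apply: nrm_fsum_le => n _; case: ifP; rewrite ?nrm0 ?nrm_ge0.
Qed.

(** The inequality holds for all partial sums and passes to the limit; thus the norm is a lattice
    norm for the coordinatewise order. *)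
Lemma nrm_mono x y :
  (forall n, nrm (coord e n x) <= nrm (coord e n y)) -> nrm x <= nrm y.
Proof.
move=> h; apply: (ler_cvg2 (cvg_nrm (@proj_cvg x)) (cvg_nrm (@proj_cvg y))) => k.
by apply: nrm_fsum_le => n _; exact: h.
Qed.

(** The single term [coord e n x *: e n] lies below [x] in modulus. This is the source of the
    continuity of coordinates. *)
Lemma nrm_coord n x : nrm (coord e n x) * nrm (e n) <= nrm x.
Proof.
rewrite -nrmZ; apply: nrm_mono => m; rewrite coordZ coord_basis.
by case: eqP => [->|_]; rewrite ?mulr1 ?mulr0 ?nrm0 ?nrm_ge0.
Qed.

Lemma nrm_coord_div n x : nrm (coord e n x) <= (nrm (e n))^-1 * nrm x.
Proof. by rewrite mulrC ler_pdivlMr ?basis_gt0 // nrm_coord. Qed.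

Definition re_coord n x := complex.Re (coord e n x).
Definition im_coord n x := complex.Im (coord e n x).

Lemma re_coord_cvg (u : nat -> E) x n :
  u @ \oo --> x -> (fun k => re_coord n (u k)) @ \oo --> re_coord n x.
Proof.
apply: (@lipschitz_cvg _ _ (re_coord n) (nrm (e n))^-1) => y z.
apply: le_trans (nrm_coord_div n _); apply: le_trans (Re_le_nrm _).
by rewrite coordB raddfB.
Qed.

Lemma im_coord_cvg (u : nat -> E) x n :
  u @ \oo --> x -> (fun k => im_coord n (u k)) @ \oo --> im_coord n x.
Proof.
apply: (@lipschitz_cvg _ _ (im_coord n) (nrm (e n))^-1) => y z.
apply: le_trans (nrm_coord_div n _); apply: le_trans (Im_le_nrm _).
by rewrite coordB raddfB.
Qed.

(* Partial sums are Cauchy by comparison with those of [y]. *)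
Lemma coord_solid (c : nat -> R[i]) y :
  (forall n, nrm (c n) <= nrm (coord e n y)) -> exists x, forall n, coord e n x = c n.
Proof.
move=> hc; pose u := series (fun n => c n *: e n).
suff cu : cvgn u by exists (limn u); apply: coord_unique.
apply: (@cvgn_dominated _ _ _ (proj^~ y) 1) => [|k N Nk].
  by apply/cvg_ex; exists y; exact: (@proj_cvg y).
rewrite mul1r.
(* Differences of partial sums are rewritten over one common range, with the first [N] coefficients
   set to zero. *)
have E1 (a : nat -> R[i]) : \sum_(0 <= n < k) a n *: e n - \sum_(0 <= n < N) a n *: e n
    = \sum_(0 <= n < k) (if (N <= n)%N then a n else 0) *: e n.
  apply: coord_inj => n; rewrite coordB !coord_fsum.
  case: (ltnP n N) => nN; last by rewrite subr0.
  by rewrite (leq_trans nN Nk) subrr.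
rewrite /proj /u /series /= !E1; apply: nrm_fsum_le => n _.
by case: ifP => // _; rewrite ?nrm0.
Qed.

End Basis.

(** * Positive operators and their matrices *)

Section Operators.
Context {R : realType} {E : completeNormedModType R[i]}.
Variable e : nat -> E.
Hypotheses (he : schauder_basis e) (hu : one_unconditional e).
Implicit Types (x y z : E) (f g : E -> E).

Lemma coord_ext n x y : re_coord e n x = re_coord e n y ->
  im_coord e n x = im_coord e n y -> coord e n x = coord e n y.
Proof.
by rewrite /re_coord /im_coord; case: (coord e n x) (coord e n y) => a b [c d] /= -> ->.
Qed.

Lemma re_im_coord_inj x y :
  (forall n, re_coord e n x = re_coord e n y /\ im_coord e n x = im_coord e n y) -> x = y.
Proof. by move=> h; apply: (coord_inj he) => n; have [] := h n; exact: coord_ext. Qed.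

Lemma re_coordD n x y : re_coord e n (x + y) = re_coord e n x + re_coord e n y.
Proof. by rewrite /re_coord coordD // raddfD. Qed.

Lemma im_coordD n x y : im_coord e n (x + y) = im_coord e n x + im_coord e n y.
Proof. by rewrite /im_coord coordD // raddfD. Qed.

Lemma re_coordZ n (c : R) x : re_coord e n (c%:C *: x) = c * re_coord e n x.
Proof. by rewrite /re_coord coordZ // ReM_R. Qed.

Lemma im_coordZ n (c : R) x : im_coord e n (c%:C *: x) = c * im_coord e n x.
Proof. by rewrite /im_coord coordZ // ImM_R. Qed.

Lemma re_coordN n x : re_coord e n (- x) = - re_coord e n x.
Proof. by rewrite /re_coord coordN // raddfN. Qed.

Lemma im_coordN n x : im_coord e n (- x) = - im_coord e n x.
Proof. by rewrite /im_coord coordN // raddfN. Qed.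

Lemma re_coordB n x y : re_coord e n (x - y) = re_coord e n x - re_coord e n y.
Proof. by rewrite re_coordD re_coordN. Qed.

Lemma im_coordB n x y : im_coord e n (x - y) = im_coord e n x - im_coord e n y.
Proof. by rewrite im_coordD im_coordN. Qed.

Lemma re_coord0 n : re_coord e n 0 = 0.
Proof. by rewrite /re_coord coord0. Qed.

Lemma im_coord0 n : im_coord e n 0 = 0.
Proof. by rewrite /im_coord coord0. Qed.

Lemma re_coord_basis n m : re_coord e n (e m) = (n == m)%:R.
Proof. by rewrite /re_coord coord_basis //; case: eqP. Qed.

Lemma im_coord_basis n m : im_coord e n (e m) = 0.
Proof. by rewrite /im_coord coord_basis //; case: eqP. Qed.

Lemma re_coord_proj n k x :
  re_coord e n (proj e k x) = if (n < k)%N then re_coord e n x else 0.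
Proof. by rewrite /re_coord coord_proj //; case: ifP. Qed.

Lemma im_coord_proj n k x :
  im_coord e n (proj e k x) = if (n < k)%N then im_coord e n x else 0.
Proof. by rewrite /im_coord coord_proj //; case: ifP. Qed.

(** Imaginary parts of coordinates are continuous and vanish on finite real combinations;
    conversely, the partial sums of a vector with real coordinates lie in the real span. *)
Lemma real_partP x : real_part e x <-> forall n, im_coord e n x = 0.
Proof.
split=> [hx n|hx B Bx].
  apply/eqP; rewrite -normr_eq0 eq_le normr_ge0 andbT; apply/ler_addgt0Pl => eps e0.
  rewrite addr0.
  have /hx[y [[k [c yE]] /= hxy]] : nbhs x [set y | nrm (x - y) < nrm (e n) * eps].
    have /cvg_nrmP : id @ nbhs x --> x by exact: cvg_id.
    by apply; rewrite mulr_gt0 // basis_gt0.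
  have -> : im_coord e n x = im_coord e n (x - y).
    by rewrite im_coordB yE {3}/im_coord coord_fsum //; case: ifP => /=; rewrite subr0.
  apply: le_trans (Im_le_nrm _) _; apply: le_trans (nrm_coord_div he hu _ _) _.
  by rewrite mulrC ler_pdivrMr ?basis_gt0 // mulrC ltW.
have [N _ hN] := @proj_cvg _ _ _ he x B Bx.
exists (proj e N x); split; last by apply: hN => /=.
exists N, (fun n => re_coord e n x); apply: eq_bigr => n _; congr (_ *: _).
exact: (complex_RE (hx n)).
Qed.

Lemma positive_coneP x :
  positive_cone e x <-> forall n, im_coord e n x = 0 /\ 0 <= re_coord e n x.
Proof.
split=> [[_ h] n|h]; first by apply/ge0_complexP; exact: h.
by split=> [|n]; [apply/real_partP => n; have [] := h n|by apply/ge0_complexP; exact: h].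
Qed.

Lemma cone_real x : positive_cone e x -> real_part e x.
Proof. by case. Qed.

Lemma cone_re_coord x : positive_cone e x -> forall n, 0 <= re_coord e n x.
Proof. by move=> /positive_coneP h n; have [] := h n. Qed.

Lemma cone_basis n : positive_cone e (e n).
Proof. by apply/positive_coneP => m; rewrite re_coord_basis im_coord_basis ler0n. Qed.

Lemma real_part_basis n : real_part e (e n).
Proof. exact/cone_real/cone_basis. Qed.

Lemma cone_proj k x : positive_cone e x -> positive_cone e (proj e k x).
Proof.
move=> /positive_coneP h; apply/positive_coneP => n; rewrite re_coord_proj im_coord_proj.
by case: ifP.
Qed.

Lemma real_part0 : real_part e 0.
Proof. by apply/real_partP => n; rewrite im_coord0. Qed.

Lemma real_part_comb (c : R) x y :
  real_part e x -> real_part e y -> real_part e (c%:C *: x + y).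
Proof.
move=> /real_partP hx /real_partP hy; apply/real_partP => n.
by rewrite im_coordD im_coordZ hx hy mulr0 addr0.
Qed.

Lemma real_partB x y : real_part e x -> real_part e y -> real_part e (x - y).
Proof.
move=> hx hy; have := @real_part_comb (-1) _ _ hy hx.
by rewrite rmorphN scaleN1r addrC.
Qed.

Lemma real_part_proj k x : real_part e x -> real_part e (proj e k x).
Proof.
move=> /real_partP h; apply/real_partP => n; rewrite im_coord_proj.
by case: ifP.
Qed.

Lemma nrm_coord_real n x : real_part e x -> nrm (coord e n x) = `|re_coord e n x|.
Proof.
by move=> /real_partP/(_ n) h; rewrite (complex_RE h) nrmR.
Qed.

(** Solidness produces the lattice modulus of [x], and monotonicity in both directions gives
    equality of norms. *)
Lemma exists_abs x :
  exists y, [/\ positive_cone e y, forall n, re_coord e n y = nrm (coord e n x) &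
              nrm y = nrm x].
Proof.
have [|y hy] := coord_solid he hu (c := fun n => (nrm (coord e n x))%:C) (y := x).
  by move=> n; rewrite nrmR ger0_norm // nrm_ge0.
have hc : positive_cone e y.
  by apply/positive_coneP => n; rewrite /im_coord /re_coord hy /= nrm_ge0.
exists y; split=> // [n|]; first by rewrite /re_coord hy.
by apply/eqP; rewrite eq_le; apply/andP; split; apply: (nrm_mono he hu) => n;
   rewrite hy nrmR ger0_norm // nrm_ge0.
Qed.

Section RealLinear.
Variable f : E -> E.
Hypothesis hf : real_linear e f.

Lemma real_linear0 : f 0 = 0.
Proof.
have [_ /(_ (-1) 0 0 real_part0 real_part0)] := hf.
by rewrite rmorphN scaler0 addr0 scaleN1r addNr.
Qed.

Lemma real_linearD x y : real_part e x -> real_part e y -> f (x + y) = f x + f y.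
Proof. by move=> hx hy; have [_ /(_ 1 x y hx hy)] := hf; rewrite !scale1r. Qed.

Lemma real_linearZ (c : R) x : real_part e x -> f (c%:C *: x) = c%:C *: f x.
Proof. 
by move=> hx; have [_ /(_ c x 0 hx real_part0)] := hf; rewrite !addr0 real_linear0 addr0.
Qed.

Lemma real_linearB x y : real_part e x -> real_part e y -> f (x - y) = f x - f y.
Proof.
move=> hx hy; have [_ /(_ (-1) y x hy hx)] := hf.
by rewrite rmorphN !scaleN1r ![- _ + _]addrC.
Qed.

Lemma real_linear_real x : real_part e x -> real_part e (f x).
Proof. by have [h _] := hf; exact: h. Qed.

Lemma real_linear_proj m k x : real_part e x ->
  re_coord e m (f (proj e k x)) =
    \sum_(0 <= n < k) re_coord e m (f (e n)) * re_coord e n x.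
Proof.
move=> hx; elim: k => [|k IH].
  by rewrite /proj !big_geq // real_linear0 re_coord0.
rewrite big_nat_recr //= -IH /proj big_nat_recr //= -/(proj e k x).
have /real_partP/(_ k) hk := hx.
rewrite (complex_RE hk) -/(re_coord e k x) real_linearD; first last.
- have := @real_part_comb (re_coord e k x) _ _ (@real_part_basis k) real_part0.
  by rewrite addr0.
- exact: real_part_proj.
rewrite re_coordD real_linearZ ?re_coordZ ?[re_coord e k x * _]mulrC //.
exact: real_part_basis.
Qed.

End RealLinear.

Definition entry f m n := re_coord e m (f (e n)).

(** Says that [f] is recovered on real vectors from its matrix. Positivity alone yields only the
    inequality of [positive_partial], so the property is tracked separately. *)
Definition normal f := forall x, real_part e x -> forall m,
  series (fun n => entry f m n * re_coord e n x) @ \oo --> re_coord e m (f x).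

Lemma positive_real_linear f : positive_op e f -> real_linear e f.
Proof. by case. Qed.

Lemma positive_entry f m n : positive_op e f -> 0 <= entry f m n.
Proof. by move=> [_ h]; apply: cone_re_coord; apply: h; exact: cone_basis. Qed.

Lemma positive_mono g x y m : positive_op e g ->
  real_part e x -> real_part e y -> (forall n, re_coord e n x <= re_coord e n y) ->
  re_coord e m (g x) <= re_coord e m (g y).
Proof.
move=> [gl gp] hx hy h; rewrite -subr_ge0 -re_coordB -(real_linearB gl) //.
apply: cone_re_coord; apply: gp; apply/positive_coneP => n; rewrite re_coordB subr_ge0 h.
by have /real_partP -> := real_partB hy hx.
Qed.

(** A positive [x] dominates its truncations, and [g] preserves the order. *)
Lemma positive_partial g x m k : positive_op e g -> positive_cone e x ->
  \sum_(0 <= n < k) entry g m n * re_coord e n x <= re_coord e m (g x).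
Proof.
move=> hg hx; have hr := cone_real hx.
rewrite -(real_linear_proj (positive_real_linear hg)) //.
apply: positive_mono => //; first exact: real_part_proj.
by move=> n; rewrite re_coord_proj; case: ifP => // _; exact: cone_re_coord.
Qed.

(** The row series at [x] converge absolutely, being dominated by the partial sums of [g] at the
    modulus [y] of [x]. Their limits are dominated by the coordinates of [g y], hence by solidness
    they are the coordinates of a vector. *)
Lemma matrix_op (M : nat -> nat -> R) g : positive_op e g ->
  (forall m n, 0 <= M m n <= entry g m n) ->
  exists S, [/\ positive_op e S, normal S & forall m n, entry S m n = M m n].
Proof.
move=> hg hM.
have main x : real_part e x -> exists w, forall m,
    series (fun n => M m n * re_coord e n x) @ \oo --> re_coord e m w /\
    im_coord e m w = 0.
  move=> hx; have [y [hy hxy _]] := exists_abs x.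
  have hz := (proj2 hg) _ hy.
  have bnd m k : \sum_(0 <= n < k) `|M m n * re_coord e n x| <= re_coord e m (g y).
    apply: le_trans (positive_partial m k hg hy); apply: ler_sum => n _.
    have /andP[M0 M1] := hM m n.
    by rewrite normrM ger0_norm // hxy nrm_coord_real // ler_wpM2r.
  have hcv m : cvgn (series (fun n => M m n * re_coord e n x)).
    apply: normed_cvg; apply: nondecreasing_is_cvgn.
      by apply: nondecreasing_series => n _ _ /=; rewrite normr_ge0.
    by exists (re_coord e m (g y)) => _ [k _ <-]; exact: (bnd m k).
  pose l m := limn (series (fun n => M m n * re_coord e n x)).
  have lb m : `|l m| <= re_coord e m (g y).
    have hl : series (fun n => M m n * re_coord e n x) @ \oo --> l m by exact: hcv.
    rewrite ler_norml lerNl; apply/andP; split.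
      apply: (@ger_cvg_from _ _ _ _ 0%N (cvgN hl)) => k _.
      apply: le_trans (bnd m k); rewrite ?opprfctE /series /= -sumrN.
      apply: ler_sum => n _.
      by rewrite -normrN ler_norm.
    apply: (@ger_cvg_from _ _ _ _ 0%N hl) => k _.
    apply: le_trans (bnd m k); rewrite /series /=; apply: ler_sum => n _.
    by rewrite ler_norm.
  have [|w hw] := coord_solid he hu (c := fun m => (l m)%:C) (y := g y).
    move=> m; rewrite nrmR nrm_coord_real; last exact: cone_real.
    by apply: le_trans (lb m) (ler_norm _).
  exists w => m; rewrite /re_coord /im_coord hw /=; split=> //; exact: hcv.
(* The vector is chosen by its coordinates; the default 0 can occur only off the real part. *)
pose S x := xget 0 [set w | forall m,
    series (fun n => M m n * re_coord e n x) @ \oo --> re_coord e m w /\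
    im_coord e m w = 0].
have SP x : real_part e x -> forall m,
    series (fun n => M m n * re_coord e n x) @ \oo --> re_coord e m (S x) /\
    im_coord e m (S x) = 0.
  move=> /main[w hw]; rewrite /S.
  by case: xgetP => [w' _ //|/(_ w)].
have lim_uniq (u : nat -> R) (a b : R) : u @ \oo --> a -> u @ \oo --> b -> a = b.
  by move=> h1 h2; rewrite -(cvg_lim _ h1) // (cvg_lim _ h2).
have ES m n : entry S m n = M m n.
  apply: (lim_uniq _ _ _ (proj1 (SP _ (@real_part_basis n) m))).
  apply/cvgrPdist_lt => eps e0; exists n.+1 => // k /= nk; rewrite /series /=.
  rewrite (eq_bigr (fun j => if j == n then M m j else 0)) => [|j _].
    by rewrite sum_pick nk subrr normr0.
  by rewrite re_coord_basis; case: eqP; rewrite ?mulr1 ?mulr0.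
have RS x : real_part e x -> real_part e (S x).
  by move=> hx; apply/real_partP => m; have [] := SP _ hx m.
exists S; split=> //; last first.
  move=> x hx m; have [h _] := SP _ hx m.
  by under eq_fun do rewrite ES.
split=> [|x hx].
  split=> // c x y hx hy; apply: re_im_coord_inj => m.
  have hxy := @real_part_comb c _ _ hx hy.
  have [_ h1] := SP _ hxy m; have [_ h2] := SP _ hx m; have [_ h3] := SP _ hy m.
  split; last by rewrite im_coordD im_coordZ h1 h2 h3 mulr0 addr0.
  apply: (lim_uniq _ _ _ (proj1 (SP _ hxy m))).
  rewrite re_coordD re_coordZ.
  have -> : series (fun n => M m n * re_coord e n (c%:C *: x + y)) =
    (fun k => c * series (fun n => M m n * re_coord e n x) k +
              series (fun n => M m n * re_coord e n y) k).
    apply/funext => k; rewrite /series /= mulr_sumr -big_split; apply: eq_bigr => n _ /=.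
    by rewrite re_coordD re_coordZ mulrDr mulrCA.
  apply: cvgD; last by have [] := SP _ hy m.
  by apply: cvgMl_tmp; have [] := SP _ hx m.
apply/positive_coneP => m; have [h1 ->] := SP _ (cone_real hx) m; split=> //.
apply: (@ler_cvg_from _ _ _ _ 0%N h1) => k _; rewrite /series /=.
apply: sumr_ge0 => n _; rewrite mulr_ge0 //; first by have /andP[] := hM m n.
exact: cone_re_coord.
Qed.

End Operators.

(** * Suprema of regular operators and the modulus *)

Section Suprema.
Context {R : realType} {E : completeNormedModType R[i]}.
Variable e : nat -> E.
Hypotheses (he : schauder_basis e) (hu : one_unconditional e).
Implicit Types (x y z : E) (f g h : E -> E).

Lemma regular_real_linear f : regular_real_op e f -> real_linear e f.
Proof.
move=> [p [q [[[pr pl] _] [[qr ql] _] pq]]]; split=> [x hx|c x y hx hy].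
  by rewrite pq //; apply: (real_partB he hu); [exact: pr|exact: qr].
rewrite !pq //; last exact: (real_part_comb he hu).
by rewrite pl // ql // scalerBr opprD addrACA.
Qed.

Lemma positive_zero : positive_op e (fun=> 0).
Proof.
split; last first.
  by move=> x hx; apply/(positive_coneP he hu) => n; rewrite re_coord0 // im_coord0.
split=> [x hx|c x y _ _]; first exact: (real_part0 he hu).
by rewrite scaler0 addr0.
Qed.

Lemma positive_regular f : positive_op e f -> regular_real_op e f.
Proof.
move=> hf; exists f, (fun=> 0); split=> //; first exact: positive_zero.
by move=> x _; rewrite subr0.
Qed.

Lemma positive_comb (c : R) f g : 0 <= c -> positive_op e f -> positive_op e g ->
  positive_op e (fun x => c%:C *: f x + g x).
Proof.
move=> c0 [[fr fl] fp] [[gr gl] gp]; split.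
  split=> [x hx|d x y hx hy].
    by apply: (real_part_comb he hu); [exact: fr|exact: gr].
  rewrite fl // gl // !scalerDr addrACA !scalerA; congr (_ + _ + _).
  by rewrite [_ * d%:C]mulrC.
move=> x hx; have := fp _ hx; have := gp _ hx.
move=> /(positive_coneP he hu) h1 /(positive_coneP he hu) h2.
apply/(positive_coneP he hu) => n.
rewrite (im_coordD he) im_coordZ // re_coordD // re_coordZ //.
have [-> h3] := h1 n; have [-> h4] := h2 n.
by rewrite mulr0 addr0 addr_ge0 // mulr_ge0.
Qed.

Lemma positiveD f g : positive_op e f -> positive_op e g ->
  positive_op e (fun x => f x + g x).
Proof.
move=> hf hg; have := @positive_comb 1 _ _ ler01 hf hg.
by under eq_fun do rewrite scale1r.
Qed.

Lemma op_leW f g x m : op_le e f g -> positive_cone e x ->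
  re_coord e m (f x) <= re_coord e m (g x).
Proof.
by move=> [_ h] /h /= /(cone_re_coord he hu)/(_ m); rewrite re_coordB // subr_ge0.
Qed.

Lemma op_leP f g : real_linear e f -> real_linear e g ->
  (forall x m, positive_cone e x -> re_coord e m (f x) <= re_coord e m (g x)) ->
  op_le e f g.
Proof.
move=> [fr fl] [gr gl] h; split.
  split=> [x hx|c x y hx hy] /=.
    by apply: (real_partB he hu); [exact: gr|exact: fr].
  by rewrite fl // gl // scalerBr opprD addrACA.
move=> x hx; apply/(positive_coneP he hu) => m /=.
rewrite re_coordB // subr_ge0 h //; split=> //.
have /(real_partP he hu) -> // : real_part e (g x - f x).
by have hr := cone_real hx; apply: (real_partB he hu); [exact: gr|exact: fr].
Qed.

(** Let [y] be the modulus of [x]. Both [g - f] and [f - g] are monotone and vanish at [y], and [x]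
    lies below [y]; so both are nonpositive at [x]. *)
Lemma op_le_eq f g x m : op_le e f g -> op_le e g f -> real_part e x ->
  re_coord e m (f x) = re_coord e m (g x).
Proof.
move=> fg gf hx; have [y [hy hyx _]] := exists_abs he hu x.
have hry := cone_real hy.
have xy n : re_coord e n x <= re_coord e n y.
  by rewrite hyx nrm_coord_real // ler_norm.
have := positive_mono he hu m fg hx hry xy; have := positive_mono he hu m gf hx hry xy.
rewrite /= !re_coordB //.
have := op_leW m fg hy; have := op_leW m gf hy; lra.
Qed.

Lemma normal_le f g x m : normal e f -> normal e g ->
  (forall n, entry e f m n <= entry e g m n) -> positive_cone e x ->
  re_coord e m (f x) <= re_coord e m (g x).
Proof.
move=> nf ng h hx; have hr := cone_real hx.
apply: (ler_cvg2 (nf _ hr m) (ng _ hr m)) => k; rewrite /series /=.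
by apply: ler_sum => n _; rewrite ler_wpM2r // (cone_re_coord he hu).
Qed.

(* An upper bound need not be normal: it can only be compared with the partial
   sums of the candidate, which is why it has to be positive. *)
Lemma op_sup_entrywise (F : set (E -> E)) g : positive_op e g -> F !=set0 ->
  (forall f, F f -> [/\ real_linear e f, normal e f &
                        forall m n, entry e f m n <= entry e g m n]) ->
  (forall m n, exists2 f, F f & 0 <= entry e f m n) ->
  (forall h, regular_real_op e h -> (forall f, F f -> op_le e f h) -> positive_op e h) ->
  [/\ is_op_sup e F (op_sup e F), positive_op e (op_sup e F), normal e (op_sup e F) &
      forall m n, entry e (op_sup e F) m n <= entry e g m n].
Proof.
move=> hg [f0 Ff0] hF F0 Fp.
(* The candidate supremum has as matrix the entrywise supremum, finite thanks to the majorant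
   [g]. *)
pose M m n := sup [set entry e f m n | f in F].
have ubM m n : ubound [set entry e f m n | f in F] (entry e g m n).
  by move=> _ [f /hF[_ _ h] <-].
have neM m n : [set entry e f m n | f in F] !=set0 by exists (entry e f0 m n), f0.
have leM f m n : F f -> entry e f m n <= M m n.
  move=> Ff; apply: ub_le_sup; last by exists f.
  by exists (entry e g m n); exact: ubM.
have hM m n : 0 <= M m n <= entry e g m n.
  apply/andP; split; last by apply: ge_sup; [exact: neM|exact: ubM].
  by have [f Ff f1] := F0 m n; apply: le_trans f1 (leM f m n Ff).
have [S [Sp Sn SM]] := matrix_op he hu hg hM.
have leS f : F f -> op_le e f S.
  move=> Ff; have [fl fn _] := hF f Ff; apply: op_leP => // [|x m hx].
    exact: positive_real_linear.
  by apply: normal_le => // n; rewrite SM; exact: leM.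
have supS : is_op_sup e F S.
  split=> //; first exact: positive_regular.
  move=> h hr hub; have hp := Fp h hr hub.
  apply: op_leP; [exact: positive_real_linear|exact: positive_real_linear|].
  move=> x m hx; apply: (@ger_cvg_from _ _ _ _ 0%N (Sn _ (cone_real hx) m)) => k _.
  apply: le_trans (positive_partial he hu m k hp hx).
  apply: ler_sum => n _; rewrite ler_wpM2r ?(cone_re_coord he hu) // SM.
  apply: ge_sup; first exact: neM.
  by move=> _ [f Ff <-]; apply: op_leW (hub _ Ff) _; exact: cone_basis.
have supF : is_op_sup e F (op_sup e F).
  by rewrite /op_sup; case: xgetP => [s _ //|/(_ S)].
have [rF uF lF] := supF; have [rS uS lS] := supS.
(* [op_sup] is a chosen supremum; antisymmetry of the order identifies it with [S] on real
   vectors. *)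
have eqS x m : real_part e x -> re_coord e m (op_sup e F x) = re_coord e m (S x).
  by move=> hx; apply: op_le_eq => //; [apply: lF|apply: lS].
have eqM m n : entry e (op_sup e F) m n = M m n.
  by rewrite /entry eqS -?SM //; exact: real_part_basis.
split=> //; first exact: Fp.
  move=> x hx m; rewrite eqS //.
  by under eq_fun do rewrite eqM -SM; exact: Sn.
by move=> m n; rewrite eqM; have /andP[] := hM m n.
Qed.

End Suprema.

(** * Real and imaginary parts of an operator, and its modulus *)

Section Modulus.
Context {R : realType} {E : completeNormedModType R[i]}.
Variable e : nat -> E.
Hypotheses (he : schauder_basis e) (hu : one_unconditional e).
Implicit Types (x y z : E) (f g h : E -> E).

Lemma re_coord_i n x : re_coord e n ('i%C *: x) = - im_coord e n x.
Proof.
rewrite /re_coord /im_coord coordZ //; case: (coord e n x) => a b /=.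
by rewrite mul0r mul1r sub0r.
Qed.

Lemma im_coord_i n x : im_coord e n ('i%C *: x) = re_coord e n x.
Proof.
rewrite /re_coord /im_coord coordZ //; case: (coord e n x) => a b /=.
by rewrite mul0r mul1r add0r.
Qed.

(** Real and imaginary parts of the coordinates are dominated by the coordinates, so solidness
    yields both components. *)
Lemma vec_split x : exists y z, [/\ real_part e y, real_part e z & x = y + 'i%C *: z].
Proof.
have [|y hy] := coord_solid he hu (c := fun n => (re_coord e n x)%:C) (y := x).
  by move=> n; rewrite nrmR; exact: Re_le_nrm.
have [|z hz] := coord_solid he hu (c := fun n => (im_coord e n x)%:C) (y := x).
  by move=> n; rewrite nrmR; exact: Im_le_nrm.
exists y, z; split; try by apply/(real_partP he hu) => n; rewrite /im_coord ?hy ?hz.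
apply: (re_im_coord_inj he) => n; rewrite re_coordD // im_coordD // re_coord_i im_coord_i.
by split; rewrite [in RHS]/re_coord [in RHS]/im_coord !hy !hz /= ?subr0 ?add0r.
Qed.

Lemma vec_reP x : real_part e (vec_re e x) /\
  forall n, re_coord e n (vec_re e x) = re_coord e n x.
Proof.
rewrite /vec_re; case: xgetP => [y _ [hy [z hz ->]]|]; last first.
  by have [y [z [hy hz xE]]] := vec_split x; move/(_ y); case; split=> //; exists z.
split=> // n; rewrite re_coordD // re_coord_i.
by move/(real_partP he hu) : hz => ->; rewrite oppr0 addr0.
Qed.

Lemma vec_imP x : real_part e (vec_im e x) /\
  forall n, re_coord e n (vec_im e x) = im_coord e n x.
Proof.
rewrite /vec_im; case: xgetP => [z _ [hz [y hy ->]]|]; last first.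
  by have [y [z [hy hz xE]]] := vec_split x; move/(_ z); case; split=> //; exists y.
split=> // n; rewrite im_coordD // im_coord_i.
by move/(real_partP he hu) : hy => ->; rewrite add0r.
Qed.

Section Linear.
Variable a : {linear E -> E}.

Lemma op_re_linear : real_linear e (op_re e a).
Proof.
split=> [x _|c x y _ _]; first by have [] := vec_reP (a x).
apply: (re_im_coord_inj he) => n.
rewrite re_coordD // im_coordD // re_coordZ // im_coordZ // /op_re /=.
have [h1 h1'] := vec_reP (a (c%:C *: x + y)); have [h2 h2'] := vec_reP (a x).
have [h3 h3'] := vec_reP (a y); move/(real_partP he hu) in h1.
move/(real_partP he hu) in h2; move/(real_partP he hu) in h3.
by rewrite h1 h2 h3 h1' h2' h3' linearP re_coordD // re_coordZ // mulr0 addr0.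
Qed.

Lemma op_im_linear : real_linear e (op_im e a).
Proof.
split=> [x _|c x y _ _]; first by have [] := vec_imP (a x).
apply: (re_im_coord_inj he) => n.
rewrite re_coordD // im_coordD // re_coordZ // im_coordZ // /op_im /=.
have [h1 h1'] := vec_imP (a (c%:C *: x + y)); have [h2 h2'] := vec_imP (a x).
have [h3 h3'] := vec_imP (a y); move/(real_partP he hu) in h1.
move/(real_partP he hu) in h2; move/(real_partP he hu) in h3.
by rewrite h1 h2 h3 h1' h2' h3' linearP im_coordD // im_coordZ // mulr0 addr0.
Qed.

Lemma entry_re m n : entry e (op_re e a) m n = complex.Re (coord e m (a (e n))).
Proof. by have [_ h] := vec_reP (a (e n)); exact: h. Qed.

Lemma entry_im m n : entry e (op_im e a) m n = complex.Im (coord e m (a (e n))).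
Proof. by have [_ h] := vec_imP (a (e n)); exact: h. Qed.

Hypothesis ca : continuous a.

Lemma linear_proj_cvg x : (fun k => a (proj e k x)) @ \oo --> a x.
Proof. exact: (cvg_comp _ _ (@proj_cvg _ _ _ he x) (ca (x := x))). Qed.

(** Continuity of [a] enters here: the partial sums of the row series are coordinates of [a] at
    truncations of [x]. *)
Lemma op_re_normal : normal e (op_re e a).
Proof.
move=> x hx m; have [_ h] := vec_reP (a x); rewrite [re_coord _ _ _]h.
have -> : series (fun n => entry e (op_re e a) m n * re_coord e n x)
    = (fun k => re_coord e m (a (proj e k x))).
  apply/funext => k; rewrite /series /= -(real_linear_proj he hu op_re_linear m k hx).
  by have [_] := vec_reP (a (proj e k x)); exact.
exact: (re_coord_cvg he hu (@linear_proj_cvg x)).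
Qed.

Lemma op_im_normal : normal e (op_im e a).
Proof.
move=> x hx m; have [_ h] := vec_imP (a x); rewrite [re_coord _ _ _]h.
have -> : series (fun n => entry e (op_im e a) m n * re_coord e n x)
    = (fun k => im_coord e m (a (proj e k x))).
  apply/funext => k; rewrite /series /= -(real_linear_proj he hu op_im_linear m k hx).
  by have [_] := vec_imP (a (proj e k x)); exact.
exact: (im_coord_cvg he hu (@linear_proj_cvg x)).
Qed.

(** The real part of [a] multiplied by the phase of angle [-t]. *)
Definition rotated (t : R) (x : E) : E :=
  (cos t)%:C *: op_re e a x + (sin t)%:C *: op_im e a x.

Lemma rotated_linear t : real_linear e (rotated t).
Proof.
have [rr rl] := op_re_linear; have [ir il] := op_im_linear.
split=> [x hx|c x y hx hy].
  apply: (real_part_comb he hu); first exact: rr.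
  rewrite -[X in real_part _ X]addr0; apply: (real_part_comb he hu); first exact: ir.
  exact: (real_part0 he hu).
rewrite /rotated rl // il // !scalerDr addrACA !scalerA.
by congr (_ + _ + (_ + _)); rewrite mulrC.
Qed.

Lemma entry_rotated t m n : entry e (rotated t) m n =
  cos t * entry e (op_re e a) m n + sin t * entry e (op_im e a) m n.
Proof. by rewrite /entry re_coordD // !re_coordZ. Qed.

Lemma rotated_normal t : normal e (rotated t).
Proof.
move=> x hx m; rewrite re_coordD // !re_coordZ //.
have -> : series (fun n => entry e (rotated t) m n * re_coord e n x) = (fun k =>
    cos t * series (fun n => entry e (op_re e a) m n * re_coord e n x) k +
    sin t * series (fun n => entry e (op_im e a) m n * re_coord e n x) k).
  apply/funext => k; rewrite /series /= !mulr_sumr -big_split; apply: eq_bigr => n _ /=.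
  by rewrite entry_rotated mulrDl !mulrA.
by apply: cvgD; apply: cvgMl_tmp; [exact: op_re_normal|exact: op_im_normal].
Qed.

Lemma opp_linear f : real_linear e f -> real_linear e (\- f).
Proof.
move=> [fr fl]; split=> [x hx|c x y hx hy] /=.
  rewrite -sub0r; apply: (real_partB he hu); first exact: (real_part0 he hu).
  exact: fr.
by rewrite fl // opprD scalerN.
Qed.

Lemma opp_normal f : normal e f -> normal e (\- f).
Proof.
move=> nf x hx m; rewrite /= re_coordN //.
have -> : series (fun n => entry e (\- f) m n * re_coord e n x) =
    (fun k => - series (fun n => entry e f m n * re_coord e n x) k).
  apply/funext => k; rewrite /series /= -sumrN; apply: eq_bigr => n _.
  by rewrite /entry /= re_coordN // mulNr.
by apply: cvgN; exact: nf.
Qed.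

(** A single positive majorant for all angles, since sines and cosines are at most 1 in modulus. It
    ensures that the suprema below exist and are computed entrywise. *)
Variable g : E -> E.
Hypothesis hg : positive_op e g.
Hypothesis ag : forall m n, `|complex.Re (coord e m (a (e n)))| +
  `|complex.Im (coord e m (a (e n)))| <= entry e g m n.

Lemma entry_rotated_le t m n : `|entry e (rotated t) m n| <= entry e g m n.
Proof.
rewrite entry_rotated; apply: le_trans (ag m n); apply: le_trans (ler_normD _ _) _.
rewrite -entry_re -entry_im; apply: lerD; rewrite normrM ler_piMl //.
  by rewrite cos_max.
by rewrite sin_max.
Qed.

Lemma real_absP t : let s := real_abs e (rotated t) in
  [/\ positive_op e s, normal e s, forall m n, entry e s m n <= entry e g m n &
      forall m n, `|entry e (rotated t) m n| <= entry e s m n].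
Proof.
have entryN m n : entry e (\- rotated t) m n = - entry e (rotated t) m n.
  by rewrite /entry /= re_coordN.
have [|f||h hr hub|[_ ub _] sp sn sg] :=
  op_sup_entrywise he hu (F := [set rotated t; \- rotated t]) hg.
- by exists (rotated t); left.
- case=> ->; split.
  + exact: rotated_linear.
  + exact: rotated_normal.
  + by move=> m n; apply: le_trans (ler_norm _) (entry_rotated_le t m n).
  + by apply: opp_linear; exact: rotated_linear.
  + by apply: opp_normal; exact: rotated_normal.
  + move=> m n; rewrite entryN; apply: le_trans (entry_rotated_le t m n).
    by rewrite -normrN ler_norm.
- move=> m n; case: (lerP 0 (entry e (rotated t) m n)) => h.
    by exists (rotated t) => //; left.
  by exists (\- rotated t); [right|rewrite entryN oppr_ge0 ltW].
(* An upper bound of [f] and [- f] is positive: adding the two inequalities on the cone gives twice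
   the bound on the right of 0. *)
- split; first exact: (regular_real_linear he hu).
  have hl := regular_real_linear he hu hr.
  move=> x hx; apply/(positive_coneP he hu) => m.
  have /(real_partP he hu) -> := real_linear_real hl (cone_real hx); split=> //.
  have := op_leW he hu m (hub _ (or_introl erefl)) hx.
  have := op_leW he hu m (hub _ (or_intror erefl)) hx.
  by rewrite /= re_coordN //; lra.
split=> // m n; rewrite ler_norml lerNl -entryN.
by apply/andP; split; apply: (op_leW he hu); try exact: (cone_basis he hu);
  apply: ub; [right|left].
Qed.

(** The angles 0 and [pi / 2] recover the real and the imaginary parts of the entries. The factor 2
    comes from bounding the modulus of a complex number by the sum of the moduli of its two
    parts. *)
Lemma op_modulusP : positive_op e (op_modulus e a) /\
  forall m n, nrm (coord e m (a (e n))) <= 2 * entry e (op_modulus e a) m n.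
Proof.
pose I := [set t : R | 0 <= t <= 2 * pi].
have pi0 : 0 <= (pi : R) := pi_ge0 R.
have I0 : I 0 by rewrite /I /= lexx mulr_ge0.
have I1 : I (pi / 2) by rewrite /I /=; apply/andP; split; lra.
pose F := [set real_abs e (rotated t) | t in I].
have F0 : F (real_abs e (rotated 0)) by exists 0.
have F1 : F (real_abs e (rotated (pi / 2))) by exists (pi / 2).
have [|_ [t It <-]||h hr hub|[_ ub _] sp _ _] := op_sup_entrywise he hu (F := F) hg.
- by exists (real_abs e (rotated 0)).
- by have [sp sn sg _] := real_absP t; split=> //; exact: positive_real_linear.
- move=> m n; exists (real_abs e (rotated 0)) => //; have [sp _ _ _] := real_absP 0.
  exact: (positive_entry he hu).
- have hl := regular_real_linear he hu hr.
  split=> // x hx; apply/(positive_coneP he hu) => m.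
  have /(real_partP he hu) -> := real_linear_real hl (cone_real hx); split=> //.
  apply: le_trans (op_leW he hu m (hub _ F0) hx).
  by have [[_ h0] _ _ _] := real_absP 0; apply: (cone_re_coord he hu); exact: h0.
split=> // m n; apply: le_trans (nrm_le_ReIm _) _; rewrite mulr2n mulrDl mul1r.
have key t : F (real_abs e (rotated t)) ->
    `|entry e (rotated t) m n| <= entry e (op_modulus e a) m n.
  move=> Ft; have [_ _ _ h] := real_absP t; apply: le_trans (h m n) _.
  by apply: (op_leW he hu); [exact: ub|exact: (cone_basis he hu)].
apply: lerD.
  have := key _ F0; rewrite entry_rotated cos0 sin0 mul1r mul0r addr0.
  by rewrite entry_re.
have := key _ F1; rewrite entry_rotated cos_pihalf sin_pihalf mul1r mul0r add0r.
by rewrite entry_im.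
Qed.

End Linear.
End Modulus.

(** * Band operators *)

Section Coarse.
Context {R : realType}.
Variable d : nat -> nat -> R.
Hypothesis dm : is_metric d.
Hypothesis dlf : uniformly_locally_finite d.

Lemma size_le_card (s : seq nat) (A : set nat) N :
  uniq s -> (forall y, y \in s -> A y) -> A #<= `I_N -> (size s <= N)%N.
Proof.
move=> us sA /pcard_leP[g]; have gi : {in s &, injective g}.
  by move=> x y /sA Ax /sA Ay; apply: inj; rewrite inE.
rewrite -(size_map g) -[leqRHS](size_iota 0 N); apply: uniq_leq_size.
  by rewrite map_inj_in_uniq.
by move=> _ /mapP[x /sA Ax ->]; rewrite mem_iota; have := @funS _ _ A `I_N g x Ax.
Qed.

(** The least colour missing from [u]; by the pigeonhole principle it is found among the first
    [size u + 1] naturals. *)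
Definition fresh (u : seq nat) : nat :=
  nth 0%N [seq c <- iota 0 (size u).+1 | c \notin u] 0.

Lemma freshP u : fresh u \notin u /\ (fresh u <= size u)%N.
Proof.
suff : fresh u \in [seq c <- iota 0 (size u).+1 | c \notin u].
  by rewrite mem_filter mem_iota /= ltnS => /andP[].
apply: mem_nth; rewrite lt0n size_filter -lt0n -has_count; apply/negPn/negP => /hasPn h.
have : (size (iota 0 (size u).+1) <= size u)%N.
  by apply: uniq_leq_size; [exact: iota_uniq|move=> c /h; rewrite negbK].
by rewrite size_iota ltnn.
Qed.

(** Greedy colouring in the order of the integers: a point has at most [N] earlier neighbours, so
    one of [N + 1] colours is free. *)
Lemma coarse_coloring (r : R) : 0 < r -> exists (L : nat) (f : nat -> nat),
  (forall x, (f x < L)%N) /\ forall x y, d x y <= r -> f x = f y -> x = y.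
Proof.
move=> r0; have [N hN] := dlf r0; have [_ _ dC _] := dm.
pose used (s : seq nat) n := [seq nth 0%N s y | y <- iota 0 n & d n y <= r].
(* [cols k] lists the colours of the first [k] points. *)
pose cols k := iteri k (fun n s => rcons s (fresh (used s n))) [::].
have size_cols n : size (cols n) = n by elim: n => //= n IH; rewrite size_rcons IH.
pose f n := fresh (used (cols n) n).
have nth_cols n y : (y < n)%N -> nth 0%N (cols n) y = f y.
  elim: n => //= n IH; rewrite ltnS leq_eqVlt nth_rcons size_cols.
  by case/predU1P => [->|yn]; rewrite ?ltnn ?eqxx // yn IH.
have usedE n : used (cols n) n = [seq f y | y <- iota 0 n & d n y <= r].
  rewrite /used; apply/eq_in_map => y; rewrite mem_filter mem_iota /= => /andP[_ yn].
  exact: nth_cols.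
have key x y : (y < x)%N -> d x y <= r -> f x <> f y.
  move=> yx dxy fE; have [/negP[]] := freshP (used (cols x) x).
  rewrite -/(f x) fE usedE; apply: map_f.
  by rewrite mem_filter dxy mem_iota.
exists N.+1, f; split=> [x|x y dxy fE].
  rewrite ltnS; apply: leq_trans (proj2 (freshP _)) _; rewrite size_map.
  apply: size_le_card (hN x); first by rewrite filter_uniq ?iota_uniq.
  by move=> y; rewrite mem_filter => /andP[].
case: (ltngtP x y) => // xy.
  by have := key _ _ xy; rewrite dC fE => /(_ dxy).
by have := key _ _ xy dxy.
Qed.

(** Balls are finite, hence so is the neighbourhood of an initial segment. This confines the first
    columns of a band to finitely many rows. *)
Lemma coarse_bounded_ball (r : R) (n0 : nat) : 0 < r ->
  exists N, forall n m, (n < n0)%N -> d n m <= r -> (m < N)%N.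
Proof.
move=> r0; have [K hK] := dlf r0; elim: n0 => [|n0 [N IH]]; first by exists 0%N.
have /finite_seqP[s sE] : finite_set [set y | d n0 y <= r].
  by apply/finite_set_leP; exists K.
exists (maxn N (\max_(y <- s) y).+1) => n m; rewrite ltnS leq_eqVlt leq_max.
case/predU1P => [->|/IH h /h -> //] nm; apply/orP; right; rewrite ltnS.
have ms : m \in s by have : [set y | d n0 y <= r] m by []; rewrite sE.
exact: (@leq_bigmax_seq _ _ _ id m ms isT).
Qed.

Lemma matching_involution (Q : nat -> nat -> Prop) :
  (forall x y, Q x y -> Q y x) -> (forall x y z, Q x y -> Q x z -> y = z) ->
  exists2 sigma : nat -> nat, involutive sigma & forall x y, Q x y -> sigma x = y.
Proof.
(* The default [x] makes unmatched points fixed. *)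
move=> Qs Qf; pose sigma x := xget x [set y | Q x y].
have sE x y : Q x y -> sigma x = y.
  by move=> Qxy; rewrite /sigma; case: xgetP => [z _ /= Qxz|/(_ y)//]; exact: Qf Qxz Qxy.
exists sigma => // x; rewrite {2}/sigma; case: xgetP => [y _ /= /Qs/sE //|h].
by rewrite /sigma; case: xgetP => // y _ /h.
Qed.

(* Properly colour the vertices at scale [2 r]: a vertex then has at most one
   neighbour of each colour, so every pair of colours defines a matching. *)
Lemma coarse_involutions (r : R) : 0 < r ->
  exists (L : nat) (sigma : nat -> nat -> nat -> nat),
  (forall p q, involutive (sigma p q)) /\
  forall n m, d n m <= r -> exists p q, [/\ (p < L)%N, (q < L)%N & sigma p q n = m].
Proof.
move=> r0; have [_ _ dC dT] := dm.
have [L [f [fL ff]]] := @coarse_coloring (2 * r) (mulr_gt0 (ltr0n _ 2) r0).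
pose Q p q x y := d x y <= r /\ ((f x = p /\ f y = q) \/ (f x = q /\ f y = p)).
have Qs p q x y : Q p q x y -> Q p q y x.
  by move=> [dxy h]; split; [rewrite dC|case: h => -[]; [right|left]].
have Qf p q x y z : Q p q x y -> Q p q x z -> y = z.
  (* Two partners of [x] are within [2 * r] of each other and have the same colour; when [x] plays
     different roles in the two pairs, [p = q]. *)
  move=> [dxy hy] [dxz hz]; apply: ff; last by move: hy hz; intuition congruence.
  apply: le_trans (dT y x z) _; rewrite dC in dxy; lra.
have inv p q := cid2 (matching_involution (Qs p q) (Qf p q)).
exists L, (fun p q => s2val (inv p q)); split=> [p q|n m nm].
  exact: (s2valP (inv p q)).
exists (f n), (f m); split=> //; apply: (s2valP' (inv (f n) (f m))).
by split=> //; left.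
Qed.

(** The kernel is the Gram kernel of the partition of unit, the sum over [k] of [phi k m * phi k n].
    Since the squares sum to 1, it equals 1 minus half the squared distance [S m n]; this form turns
    small variation directly into the last estimate. *)
Lemma property_A_kernel (r eps : R) : property_A d -> 0 < r -> 0 < eps ->
  exists (K : nat -> nat -> R) (D : R), [/\ 0 < D,
    forall m n, 0 <= K m n <= 1,
    forall m n, D < d m n -> K m n = 0 &
    forall m n, d m n <= r -> 1 - K m n <= eps].
Proof.
(* Capping at 1 ensures that the square of [eta] is at most [eps]. *)
move=> hA r0 eps0; pose eta := Num.min 1 eps.
have eta0 : 0 < eta by rewrite lt_min ltr01.
have eta1 : eta <= 1 by rewrite ge_min lexx.
have eta2 : eta <= eps by rewrite ge_min lexx orbT.
(* The scale [r + 1] absorbs the strict inequality in the definition of variation. *)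
have [phi [[p01 _ [D0 hD] p1] hv]] := hA (r + 1) eta (addr_gt0 r0 ltr01) eta0.
pose S m n := (\sum_(0 <= k <oo) (`|phi k m - phi k n| ^+ 2)%:E)%E.
have S0 m n : (0 <= S m n)%E by apply: nneseries_ge0 => k _ _; rewrite lee_fin sqr_ge0.
have sum2 m n : (\sum_(0 <= k <oo) ((phi k m ^+ 2)%:E + (phi k n ^+ 2)%:E) = 2%:E)%E.
  rewrite nneseriesD ?p1 // => k _ _; by rewrite lee_fin sqr_ge0.
have S2 m n : (S m n <= 2%:E)%E.
  rewrite -(sum2 m n); apply: lee_nneseries => [k _ _|k _].
    by rewrite lee_fin sqr_ge0.
  rewrite -EFinD lee_fin real_normK ?num_real //.
  have /andP[a0 _] := p01 k m; have /andP[b0 _] := p01 k n.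
  by rewrite sqrrB lerD2r gerBl mulrn_wge0 // mulr_ge0.
have Sfin m n : (fine (S m n))%:E = S m n.
  by rewrite fineK // ge0_fin_numE // (le_lt_trans (S2 m n)) // ltry.
exists (fun m n => 1 - fine (S m n) / 2), (Num.max D0 1); split.
- by rewrite lt_max ltr01 orbT.
- move=> m n; have := S0 m n; have := S2 m n; rewrite -Sfin !lee_fin.
  by move=> *; apply/andP; split; lra.
(* Far apart points share no support, so the cross terms vanish and [S m n] is 2. *)
- move=> m n; rewrite gt_max => /andP[hD0 _].
  suff SE : S m n = 2%:E by rewrite SE /= divff ?subrr.
  rewrite -(sum2 m n); apply: eq_eseriesr => k _; rewrite -EFinD; congr EFin.
  rewrite real_normK ?num_real // sqrrB.
  have [->|h1] := eqVneq (phi k m) 0; first by rewrite mul0r mul0rn subr0.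
  have [->|h2] := eqVneq (phi k n) 0; first by rewrite mulr0 mul0rn subr0.
  by have := hD _ _ _ h1 h2; rewrite leNgt hD0.
- move=> m n mn; have : (S m n < (eta ^+ 2)%:E)%E by apply: hv; lra.
  rewrite -Sfin lte_fin expr2 => h.
  have : eta * eta <= eta by rewrite ler_piMr // ltW.
  by lra.
Qed.

End Coarse.

(** * Bounded positive majorants of bands, from the symmetry of the basis *)

Section BandOperators.
Context {R : realType} {E : completeNormedModType R[i]}.
Variable e : nat -> E.
Hypotheses (he : schauder_basis e) (hu : one_unconditional e).
Hypothesis hs : symmetric_basis e.

(** Symmetry bounds each increment of the permuted expansion by [lam] times that of the original
    one, so the permuted expansion converges. *)
Lemma symmetric_op (sigma : nat -> nat) : involutive sigma ->
  exists (V : E -> E) (lam : R), [/\ 0 <= lam, forall x, nrm (V x) <= lam * nrm x &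
    forall x m, coord e m (V x) = coord e (sigma m) x].
Proof.
move=> sK; have [lam lam1 hlam] := hs (inv_bij sK).
have lam0 : 0 <= lam by apply: le_trans lam1.
have main x : exists y, nrm y <= lam * nrm x /\
    forall m, coord e m y = coord e (sigma m) x.
  pose u k := \sum_(0 <= n < k) coord e n x *: e (sigma n).
  have bnd k (al : nat -> R[i]) : nrm (\sum_(0 <= n < k) al n *: e (sigma n)) <=
      lam * nrm (\sum_(0 <= n < k) al n *: e n).
    have /andP[_] := hlam k al.
    by rewrite !nrmE -rmorphM /= lecR.
  have /cvg_ex[y /= uy] : cvgn u.
    apply: (@cvgn_dominated _ _ _ (proj e ^~ x) lam) => [|k l lk].
      by apply/cvg_ex; exists x; exact: (@proj_cvg _ _ _ he x).
    have E1 (b : nat -> E) : \sum_(0 <= n < k) coord e n x *: b n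
        - \sum_(0 <= n < l) coord e n x *: b n
        = \sum_(0 <= n < k) (if (l <= n)%N then coord e n x else 0) *: b n.
      rewrite (big_cat_nat (n := l)) //= addrAC subrr add0r.
      rewrite [RHS](big_cat_nat (n := l)) //=.
      rewrite [X in _ = X + _]big_nat_cond [X in _ = X + _]big1 => [|n]; last first.
        by rewrite andbT /= ltnNge => /negbTE ->; rewrite scale0r.
      rewrite add0r big_nat_cond [RHS]big_nat_cond.
      by apply: eq_bigr => n /andP[/andP[-> _] _].
    by rewrite /u /proj !E1; exact: bnd.
  (* Coordinate [m] is contributed by the term [n = sigma m] and is constant afterwards, which
     determines it in the limit. *)
  have cu m k : (sigma m < k)%N -> coord e m (u k) = coord e (sigma m) x.
    move=> mk; rewrite /u coord_sum //.
    rewrite (eq_bigr (fun n => if n == sigma m then coord e n x else 0)) => [|n _].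
      by rewrite sum_pick mk.
    rewrite coordZ // coord_basis // -(inj_eq (inv_inj sK)) sK eq_sym.
    by case: eqP; rewrite ?mulr1 ?mulr0.
  exists y; split.
    apply: (@ger_cvg_from _ _ _ _ 0%N (cvg_nrm uy)) => k _.
    apply: le_trans (bnd k _) _; rewrite ler_wpM2l //.
    exact: (nrm_proj_le he hu k x).
  have lim_const (v : nat -> R) (b c : R) N : v @ \oo --> b ->
      (forall k, (N < k)%N -> v k = c) -> b = c.
    move=> vb hv; apply/eqP; rewrite eq_le; apply/andP; split.
      by apply: (@ger_cvg_from _ _ _ _ N.+1 vb) => k /hv ->.
    by apply: (@ler_cvg_from _ _ _ _ N.+1 vb) => k /hv ->.
  move=> m; apply/eqP; rewrite eq_complex; apply/andP; split; apply/eqP.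
    apply: (lim_const _ _ _ (sigma m) (re_coord_cvg he hu (n := m) uy)) => k /cu.
    by rewrite /re_coord => ->.
  apply: (lim_const _ _ _ (sigma m) (im_coord_cvg he hu (n := m) uy)) => k /cu.
  by rewrite /im_coord => ->.
pose V x := s2val (cid2 (let: ex_intro y (conj a b) := main x in ex_intro2 _ _ y a b)).
exists V, lam; split=> // x.
  by rewrite /V; case: cid2.
by rewrite /V; case: cid2.
Qed.

Definition bounded_positive (G : E -> E) : Prop :=
  positive_op e G /\ exists2 lam : R, 0 <= lam & forall x, nrm (G x) <= lam * nrm x.

Lemma symmetric_positive (sigma : nat -> nat) : involutive sigma ->
  exists2 V, bounded_positive V & forall n, entry e V (sigma n) n = 1.
Proof.
move=> sK; have [V [lam [lam0 Vb Vc]]] := symmetric_op sK.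
exists V; last by move=> n; rewrite /entry /re_coord Vc sK coord_basis // eqxx.
split; last by exists lam.
split; last first.
  move=> x /(positive_coneP he hu) hx; apply/(positive_coneP he hu) => n.
  by have [] := hx (sigma n); rewrite /im_coord /re_coord Vc.
split=> [x /(real_partP he hu) hx|c x y _ _].
  by apply/(real_partP he hu) => n; have := hx (sigma n); rewrite /im_coord Vc.
by apply: (coord_inj he) => n; rewrite Vc !coord_linear // !Vc.
Qed.

(** Entries of positive operators are nonnegative, so a finite sum dominates each summand
    entrywise. *)
Lemma bounded_positive_sum (I : eqType) (s : seq I) (W : I -> E -> E) :
  (forall i, bounded_positive (W i)) ->
  exists2 G, bounded_positive G &
    forall i m n, i \in s -> entry e (W i) m n <= entry e G m n.
Proof.
move=> hW; elim: s => [|i s [G [Gp [lam lam0 Gb]] Ge]].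
  exists (fun=> 0) => //; split; first exact: positive_zero.
  by exists 0 => // x; rewrite nrm0 mul0r.
have [Wp [mu mu0 Wb]] := hW i; exists (fun x => W i x + G x).
  split; first exact: positiveD.
  exists (mu + lam); first exact: addr_ge0.
  by move=> x; apply: le_trans (nrmD _ _) _; rewrite mulrDl lerD.
move=> j m n; rewrite in_cons {2}/entry re_coordD // -!/(entry _ _ _ _).
case/predU1P => [->|js].
  by rewrite lerDl (positive_entry he hu).
by apply: le_trans (Ge j m n js) _; rewrite lerDr (positive_entry he hu).
Qed.

Variable d : nat -> nat -> R.
Hypotheses (dm : is_metric d) (dlf : uniformly_locally_finite d).

(** Sum the permutation operators over all pairs of colours: every position of the band lies on the
    graph of one of the involutions, where the entry is 1. *)
Lemma band_majorant (r : R) : 0 < r ->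
  exists2 G, bounded_positive G & forall m n, d n m <= r -> 1 <= entry e G m n.
Proof.
move=> r0; have [L [sigma [sK hsig]]] := coarse_involutions dm dlf r0.
have W (pq : nat * nat) := cid2 (symmetric_positive (sK pq.1 pq.2)).
have [|G hG GE] := @bounded_positive_sum _
  [seq (p, q) | p <- iota 0 L, q <- iota 0 L] (fun pq => s2val (W pq)).
  by move=> pq; exact: (s2valP (W pq)).
exists G => // m n /hsig[p [q [pL qL <-]]].
rewrite -(s2valP' (W (p, q)) n); apply: GE.
by apply: allpairs_f; rewrite mem_iota.
Qed.

End BandOperators.

(** * Compactness of ghosts *)

Section Compactness.
Context {R : realType} {E : completeNormedModType R[i]}.
Variable e : nat -> E.
Hypotheses (he : schauder_basis e) (hu : one_unconditional e).

(** The tail map is linear and [proj] is a contraction, whence the constant 2. *)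
Lemma nrm_tail_lipschitz N x y :
  `|nrm (x - proj e N x) - nrm (y - proj e N y)| <= 2 * nrm (x - y).
Proof.
have pB u v : proj e N (u - v) = proj e N u - proj e N v.
  have := proj_linear he N (-1) v u; rewrite !scaleN1r.
  by rewrite ![- _ + _]addrC.
have h u v : nrm (u - proj e N u) - nrm (v - proj e N v) <= 2 * nrm (u - v).
  apply: le_trans (ler_nrm_dist _ _) _.
  have -> : u - proj e N u - (v - proj e N v) = u - v - proj e N (u - v).
    by rewrite pB !opprB addrACA [RHS]addrACA; congr (_ + _); exact: addrC.
  apply: le_trans (nrmB _ _) _; have := nrm_proj_le he hu N (u - v); lra.
rewrite ler_norml h andbT lerNl opprB [nrm (x - y)]nrm_distC; exact: h.
Qed.

Lemma closure_nrm (A : set E) x (eps : R) : closure A x -> 0 < eps ->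
  exists2 y, A y & nrm (x - y) < eps.
Proof.
move=> hx e0; have /hx[y [Ay /= hxy]] : nbhs x [set y | nrm (x - y) < eps].
  have /cvg_nrmP : id @ nbhs x --> x by exact: cvg_id.
  exact.
by exists y.
Qed.

Lemma ultra_fmap (T U : Type) (f : T -> U) (F : set_system T) :
  UltraFilter F -> UltraFilter (fmap f F).
Proof.
move=> FU; split=> [|G GF FG]; first exact: fmap_proper_filter.
rewrite predeqE => A; split; last exact: FG.
move=> GA; have [//|FA] := in_ultra_setVsetC (f @^-1` A) FU.
by have [y []] := filter_ex (filterI GA (FG (~` A) FA)).
Qed.

Lemma ultra_bounded_cvg (F : set_system E) (f : E -> R) (M : R) :
  UltraFilter F -> F [set x | `|f x| <= M] -> exists l : R, f @ F --> l.
Proof.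
move=> FU FM; have := @segment_compact R (- M) M; rewrite compact_ultra => h.
have [||l [_ hl]] := h (f @ F); last by exists l.
  exact: ultra_fmap.
suff : F [set x | f x \in `[- M, M]] by [].
by apply: filterS FM => x /=; rewrite ler_norml in_itv.
Qed.

(* Each coordinate converges along an ultrafilter, and the tails are uniformly
   small, so the ultrafilter is Cauchy. *)
Lemma precompact_tails (A : set E) (M : R) :
  (forall x, A x -> nrm x <= M) ->
  (forall eta : R, 0 < eta -> exists N, forall x, A x -> nrm (x - proj e N x) <= eta) ->
  precompact A.
Proof.
move=> hM hA; rewrite precompactE compact_ultra => F FU FA.
have cM x : closure A x -> nrm x <= M + 1.
  move=> hx; have [y Ay xy] := closure_nrm hx ltr01.
  have := ler_nrm_dist x y; have := hM y Ay; lra.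
(* Passing to the closure costs [2 * eta] by the Lipschitz bound on tails, besides the original
   [eta]. *)
have cA (eta : R) : 0 < eta ->
    exists N, forall x, closure A x -> nrm (x - proj e N x) <= 3 * eta.
  move=> eta0; have [N hN] := hA _ eta0; exists N => x hx.
  have [y Ay xy] := closure_nrm hx eta0; have := hN _ Ay.
  have := nrm_tail_lipschitz N x y; rewrite ler_norml => /andP[_]; lra.
have coordF n (tau : R) : 0 < tau ->
    exists z, F [set y | nrm (z - coord e n y) * nrm (e n) < tau].
  move=> tau0; have en := basis_gt0 he n.
  have bnd y : closure A y -> nrm (coord e n y) <= (nrm (e n))^-1 * (M + 1).
    move=> /cM hy; apply: le_trans (nrm_coord_div he hu n y) _.
    by rewrite ler_wpM2l // invr_ge0 nrm_ge0.
  have [|l hl] := @ultra_bounded_cvg F (re_coord e n) ((nrm (e n))^-1 * (M + 1)) FU.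
    by apply: filterS FA => y /bnd; apply: le_trans; exact: Re_le_nrm.
  have [|l' hl'] := @ultra_bounded_cvg F (im_coord e n) ((nrm (e n))^-1 * (M + 1)) FU.
    by apply: filterS FA => y /bnd; apply: le_trans; exact: Im_le_nrm.
  have t0 : 0 < tau / nrm (e n) / 2 by rewrite !divr_gt0.
  move/cvgrPdist_lt : hl => /(_ _ t0) h; move/cvgrPdist_lt : hl' => /(_ _ t0) h'.
  exists (l +i* l')%C; apply: filterS2 h h' => y /= h h'.
  rewrite -ltr_pdivlMr //; apply: le_lt_trans (nrm_le_ReIm _) _.
  rewrite [ltRHS]splitr; move: h h'; rewrite /re_coord /im_coord.
  by case: (coord e n y) => a b /= h h'; exact: ltrD.
suff /cauchy_cvg/cvg_ex[p hp] : cauchy F.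
  exists p; split=> //; apply: (@closed_closure _ A) => B /hp FB.
  by have [y [? ?]] := filter_ex (filterI FA FB); exists y.
apply: cauchy_exP => eps eps0.
have /complex_RE eE : complex.Im eps = 0 by have /ge0_complexP[] := ltW eps0.
set r := complex.Re eps in eE.
have r0 : 0 < r by rewrite -ltcR -eE.
(* Each tail is then at most [r / 4], so two tails cost [r / 2]. *)
have [|N hN] := cA (r / 12); first by rewrite divr_gt0.
(* Comparing [N] coordinates through [z] costs [2 * tau] each; dividing by [N + 1] keeps the total
   strictly below [r / 2], even for [N = 0]. *)
pose tau := r / 4 / N.+1%:R.
have tau0 : 0 < tau by rewrite !divr_gt0 // ltr0n.
have [x Ax Fx] : exists2 x, closure A x &
    F [set y | closure A y /\ nrm (proj e N x - proj e N y) <= N%:R * (2 * tau)].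
  have [z hz] := choice (fun n => coordF n tau tau0).
  have FN k :
      F [set y | forall n, (n < k)%N -> nrm (z n - coord e n y) * nrm (e n) < tau].
    elim: k => [|k IH]; first by apply: filterS filterT => y _ n.
    apply: filterS2 IH (hz k) => y IH hk n; rewrite ltnS leq_eqVlt => /predU1P[->//|].
    exact: IH.
  have [x [Ax hx]] := filter_ex (filterI FA (FN N)); exists x => //.
  apply: filterS2 FA (FN N) => y Ay hy; split=> //.
  rewrite /proj -sumrB; apply: le_trans (nrm_sum _ _ _) _.
  rewrite -[in leRHS](subn0 N) mulr_natl -sumr_const_nat.
  rewrite [leLHS]big_nat_cond [leRHS]big_nat_cond.
  apply: ler_sum => n /andP[/andP[_ nN] _].
  rewrite -scalerBl nrmZ.
  have -> : coord e n x - coord e n y = (z n - coord e n y) - (z n - coord e n x).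
    by rewrite opprB [RHS]addrC addrA subrK.
  apply: le_trans (ler_wpM2r (nrm_ge0 _) (nrmB _ _)) _.
  by rewrite mulrDl; have := hx _ nN; have := hy _ nN; lra.
exists x; apply: filterS Fx => y [Ay hxy]; rewrite -ball_normE /= nrmE eE ltcR.
have -> : x - y = (x - proj e N x) - (y - proj e N y) + (proj e N x - proj e N y).
  rewrite -[RHS]addrA -[LHS](subrKA (proj e N x)); congr (_ + _).
  by rewrite opprB [RHS]addrC addrA subrK.
apply: le_lt_trans (nrmD _ _) _.
have h1 := nrmB (x - proj e N x) (y - proj e N y).
have h2 := hN _ Ax; have h3 := hN _ Ay.
have h4 : N%:R * (2 * tau) < r / 2.
  have -> : r / 2 = N.+1%:R * (2 * tau).
    by rewrite /tau; field; rewrite addrC natr1 pnatr_eq0.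
  by rewrite ltr_pM2r ?ltr_nat // mulr_gt0.
lra.
Qed.

End Compactness.

(** * Ghosts in the regular uniform Roe algebra *)

Section Ghosts.
Context {R : realType} {E : completeNormedModType R[i]}.
Variable e : nat -> E.
Hypotheses (he : schauder_basis e) (hu : one_unconditional e).

Lemma bounded_linear (a : {linear E -> E}) : continuous a ->
  exists2 B : R, 0 <= B & forall x, nrm (a x) <= B * nrm x.
Proof.
move=> /linear_bounded_continuous/linear_boundedP[M [Mr hM]].
have M1 : M < (`|complex.Re M| + 1)%:C.
  rewrite -(RRe_real Mr) ltcR /= (le_lt_trans (ler_norm _)) //.
  by rewrite ltrDl.
exists (`|complex.Re M| + 1); first exact: addr_ge0.
by move=> x; have := hM _ M1 x; rewrite !nrmE -rmorphM /= lecR.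
Qed.

Lemma regular_norm_bound (a : E -> E) (eps : R) :
  real_linear e (op_modulus e a) -> (regular_norm e a < eps%:E)%E ->
  forall x, real_part e x -> nrm (op_modulus e a x) <= eps * nrm x.
Proof.
move=> hl ha x hx; have [x0|xn] := eqVneq (nrm x) 0.
  by rewrite (nrm_eq0 x0) (real_linear0 he hu hl) !nrm0 mulr0.
have xp : 0 < nrm x by rewrite lt_neqAle nrm_ge0 eq_sym xn.
rewrite -ler_pdivrMr // mulrC.
have rN : nrm ((nrm x)^-1%:C : R[i]) = (nrm x)^-1.
  by rewrite nrmR ger0_norm // invr_ge0 nrm_ge0.
rewrite -{1}rN -nrmZ -(real_linearZ he hu hl _ hx) -lee_fin.
apply: le_trans (ltW ha); apply: ereal_sup_ubound; exists ((nrm x)^-1%:C *: x) => //.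
split; last by rewrite ler_nrmE nrmZ rN mulVf.
rewrite -[X in real_part _ X]addr0; apply: (real_part_comb he hu) => //.
exact: (real_part0 he hu).
Qed.

(** By the triangle inequality, the finite matrix applied to [x] is dominated coordinatewise by [G]
    applied to the truncated modulus of [x]. *)
Lemma majorant_bound (A : nat -> nat -> R[i]) (G : E -> E) (C : R) k l x :
  positive_op e G -> 0 <= C -> (forall y, real_part e y -> nrm (G y) <= C * nrm y) ->
  (forall m n, nrm (A m n) <= entry e G m n) ->
  nrm (\sum_(0 <= m < k) (\sum_(0 <= n < l) A m n * coord e n x) *: e m) <= C * nrm x.
Proof.
move=> hG C0 GC hA; have [y [hy hyx <-]] := exists_abs he hu x.
have hp := cone_real (cone_proj he hu l hy).
apply: (@le_trans _ _ (C * nrm (proj e l y))); last first.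
  by rewrite ler_wpM2l // (nrm_proj_le he hu).
apply: le_trans (GC _ hp); apply: (nrm_mono he hu) => m.
rewrite coord_fsum // [leRHS](nrm_coord_real he hu); last first.
  by apply: real_linear_real hp; exact: positive_real_linear.
case: ifP => _; last by rewrite nrm0 normr_ge0.
apply: le_trans (nrm_sum _ _ _) _; apply: le_trans (ler_norm _).
rewrite (real_linear_proj he hu (positive_real_linear hG)).
  by apply: ler_sum => n _; rewrite nrmM hyx ler_wpM2r ?nrm_ge0 //; exact: hA.
exact: cone_real.
Qed.

Hypothesis hs : symmetric_basis e.
Variable d : nat -> nat -> R.
Hypotheses (dm : is_metric d) (dlf : uniformly_locally_finite d).

(** The basis need not be normalized: the band majorant bounds [nrm (e n)] by [lam * nrm (e m)] for
    nearby indices, and boundedness of [b] does the rest. *)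
Lemma band_entry_bound (b : {linear E -> E}) (r : R) : 0 < r -> continuous b ->
  exists2 C : R, 0 <= C & forall m n, d n m <= r -> nrm (coord e m (b (e n))) <= C.
Proof.
move=> r0 /bounded_linear[B B0 hB]; have [_ _ dC _] := dm.
have [G [_ [lam lam0 hG]] G1] := band_majorant he hu hs dm dlf r0.
exists (B * lam); first exact: mulr_ge0.
move=> m n nm; have em := basis_gt0 he m.
rewrite -(ler_pM2r em); apply: le_trans (nrm_coord he hu _ _) _.
apply: le_trans (hB _) _; rewrite -mulrA ler_wpM2l //.
apply: le_trans (hG _); apply: le_trans (nrm_coord he hu n _).
rewrite ler_peMl ?nrm_ge0 //; apply: le_trans (Re_le_nrm _).
by apply: le_trans (ler_norm _); apply: G1; rewrite dC.
Qed.

Variable a : {linear E -> E}.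
Hypotheses (hA : property_A d) (ha : regular_roe e d a) (ag : ghost e a).

Lemma ghost_tail_majorant (eta : R) : 0 < eta ->
  exists N (G : E -> E), [/\ positive_op e G,
  forall y, real_part e y -> nrm (G y) <= eta * nrm y &
  forall m n, (N <= m)%N -> nrm (coord e m (a (e n))) <= entry e G m n].
Proof.
move=> eta0; have [_ _ dC _] := dm; have [ca [hre him] happ] := ha.
(* Four shares: two for the modulus of [a - b], which enters with factor 2, and one for each of the
   other two terms. *)
pose del := eta / 4; have del0 : 0 < del by rewrite divr_gt0.
have [b [cb [r r0 hb] hnorm]] := happ _ del0.
have [C C0 hC] := band_entry_bound r0 cb.
have [Gr [Grp [lr lr0 Grb]] Gr1] := band_majorant he hu hs dm dlf r0.
have bGr m n : nrm (coord e m (b (e n))) <= C * entry e Gr m n.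
  have [nm|nm] := lerP (d n m) r.
    by apply: le_trans (hC _ _ nm) _; rewrite ler_peMr // Gr1.
  by rewrite hb // nrm0 mulr_ge0 // (positive_entry he hu).
have [p [q [pp qp pqE]]] := hre; have [p' [q' [pp' qp' pqE']]] := him.
have cab : continuous (a \- b)%R by move=> x; apply: cvgB; [exact: ca|exact: cb].
(* An entrywise majorant of [a - b], from the positive parts of [a] and the band of [b] counted once
   for the real and once for the imaginary part. It grants access to the modulus; smallness comes
   from [hnorm]. *)
pose g x := (2 * C)%:C *: Gr x + (p x + q x + (p' x + q' x)).
have gp : positive_op e g.
  apply: (positive_comb he hu); rewrite ?mulr_ge0 //.
  by apply: (positiveD he hu); apply: (positiveD he hu).
have hg m n : `|complex.Re (coord e m ((a \- b)%R (e n)))| +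
    `|complex.Im (coord e m ((a \- b)%R (e n)))| <= entry e g m n.
  have en := real_part_basis he hu (n := n).
  have Ea : complex.Re (coord e m (a (e n))) = entry e p m n - entry e q m n.
    by rewrite -entry_re // /entry pqE // re_coordB.
  have Ea' : complex.Im (coord e m (a (e n))) = entry e p' m n - entry e q' m n.
    by rewrite -entry_im // /entry pqE' // re_coordB.
  have Eg : entry e g m n = 2 * C * entry e Gr m n +
     (entry e p m n + entry e q m n + (entry e p' m n + entry e q' m n)).
    by rewrite /entry /g re_coordD // re_coordZ // !re_coordD.
  rewrite /= coordB // !raddfB /= Ea Ea' Eg.
  have h1 := le_trans (Re_le_nrm _) (bGr m n).
  have h2 := le_trans (Im_le_nrm _) (bGr m n).
  have := positive_entry he hu m n pp; have := positive_entry he hu m n qp.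
  have := positive_entry he hu m n pp'; have := positive_entry he hu m n qp'.
  move: h1 h2; rewrite !ler_norml => /andP[h1 h1'] /andP[h2 h2'] h3 h4 h5 h6.
  have k (u v w c : R) : 0 <= u -> 0 <= v -> - c <= w -> w <= c ->
      `|u - v - w| <= u + v + c.
    by move=> *; rewrite ler_norml; apply/andP; split; lra.
  have k1 := k _ _ _ _ h6 h5 h1 h1'; have k2 := k _ _ _ _ h4 h3 h2 h2'; lra.
pose c : {linear E -> E} := (a \- b)%R.
have [sp sE] := op_modulusP he hu (a := c) cab gp hg.
set s := op_modulus e (a \- b) in sp sE.
have sb := regular_norm_bound (positive_real_linear sp) hnorm.
(* Chosen so that [eps * C * lr] is at most [del]; adding 1 keeps the divisor positive. *)
pose eps := del / (C * lr + 1); have eps0 : 0 < eps.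
  by rewrite divr_gt0 // ltr_pwDr // mulr_ge0.
have epsC : 0 <= eps * C by apply: mulr_ge0 => //; exact: ltW.
have [K [D [D0 K01 KD Kr]]] := property_A_kernel hA r0 eps0.
have [GD [GDp [lD lD0 GDb]] GD1] := band_majorant he hu hs dm dlf D0.
pose nu := del / (lD + 1); have nu0 : 0 < nu by rewrite divr_gt0 // ltr_pwDr.
have [n0 hn0] := ag nu0.
(* In rows from [N] on, the band of width [D] meets only columns from [n0] on, where the ghost
   estimate applies. *)
have [N hN] := coarse_bounded_ball dlf n0 D0.
pose G x := 2%:C *: s x + ((eps * C)%:C *: Gr x + (nu%:C *: GD x + 0)).
exists (maxn n0 N), G; split.
- do 2![apply: (positive_comb he hu) => //].
  by apply: (positive_comb he hu); rewrite ?ltW //; exact: positive_zero.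
- move=> y hy.
  have E1 : nrm (2%:C *: s y) <= 2 * (del * nrm y).
    by rewrite nrmZ nrmR ger0_norm // ler_wpM2l // sb.
  have E2 : nrm ((eps * C)%:C *: Gr y) <= del * nrm y.
    rewrite nrmZ nrmR ger0_norm //.
    apply: (@le_trans _ _ (eps * C * (lr * nrm y))); first exact: ler_wpM2l.
    rewrite mulrA -(mulrA eps) ler_wpM2r ?nrm_ge0 // /eps mulrAC.
    by rewrite ler_pdivrMr ?ltr_pwDr ?mulr_ge0 // ler_pM2l // lerDl.
  have E3 : nrm (nu%:C *: GD y) <= del * nrm y.
    rewrite nrmZ nrmR ger0_norm ?(ltW nu0) //.
    apply: (@le_trans _ _ (nu * (lD * nrm y))).
      by rewrite ler_wpM2l ?(ltW nu0).
    rewrite mulrA ler_wpM2r ?nrm_ge0 // /nu mulrAC.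
    by rewrite ler_pdivrMr ?ltr_pwDr // ler_pM2l // lerDl.
  rewrite /G /= addr0; apply: le_trans (nrmD _ _) _.
  have E4 := nrmD ((eps * C)%:C *: Gr y) (nu%:C *: GD y).
  have -> : eta = 4 * del by rewrite /del mulrC divfK.
  rewrite -mulrA; lra.
move=> m n; rewrite geq_max => /andP[mn0 mN].
have -> : entry e G m n =
    2 * entry e s m n + (eps * C * entry e Gr m n + nu * entry e GD m n).
  by rewrite /entry /G /= addr0 re_coordD // re_coordZ // re_coordD // !re_coordZ.
have /andP[K0 K1] := K01 m n.
(* The three terms are matched in order with those of [G]. *)
have -> : coord e m (a (e n)) = (1 - K m n)%:C * coord e m ((a \- b)%R (e n)) +
    ((1 - K m n)%:C * coord e m (b (e n)) + (K m n)%:C * coord e m (a (e n))).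
  rewrite /= coordB // addrA -mulrDr subrK -mulrDl -rmorphD /= subrK.
  by rewrite mul1r.
apply: le_trans (nrmD _ _) _; apply: lerD.
  apply: le_trans (sE m n); rewrite nrmM nrmR ger0_norm ?subr_ge0 //.
  by rewrite ler_piMl ?nrm_ge0 // gerBl.
apply: le_trans (nrmD _ _) _; apply: lerD.
  rewrite nrmM nrmR ger0_norm ?subr_ge0 //.
  have [mr|mr] := lerP (d n m) r; last first.
    by rewrite hb // nrm0 mulr0 mulr_ge0 // (positive_entry he hu).
  rewrite -mulrA; apply: ler_pM; rewrite ?subr_ge0 ?nrm_ge0 //.
  by apply: Kr; rewrite dC.
rewrite nrmM nrmR ger0_norm //.
have [mD|mD] := lerP (d n m) D; last first.
  by rewrite KD 1?dC // mul0r mulr_ge0 ?(ltW nu0) // (positive_entry he hu).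
have nn0 : (n0 <= n)%N.
  by rewrite leqNgt; apply/negP => /hN/(_ mD); rewrite ltnNge mN.
have := hn0 n m nn0 mn0; rewrite ler_nrmE => h.
apply: (@le_trans _ _ nu); last by rewrite ler_peMr ?(ltW nu0) // GD1.
by apply: le_trans h; rewrite ler_piMl // nrm_ge0.
Qed.

(** Rows and columns are first truncated so that [majorant_bound] applies; the row limit is taken
    first, then the column limit by continuity of [a]. *)
Lemma ghost_tails (eta : R) : 0 < eta ->
  exists N, forall x, nrm (a x - proj e N (a x)) <= eta * nrm x.
Proof.
move=> eta0; have [N [G [Gp Gb GE]]] := ghost_tail_majorant eta0.
have [ca _ _] := ha; exists N => x.
have fin l : nrm (a (proj e l x) - proj e N (a (proj e l x))) <= eta * nrm x.
  set z := a _.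
  have cz : (fun k => nrm (proj e k z - proj e N z)) @ \oo --> nrm (z - proj e N z).
    by apply: cvg_nrm; apply: cvgB; [exact: (@proj_cvg _ _ _ he z)|exact: cvg_cst].
  apply: (@ger_cvg_from _ _ _ _ N cz) => k Nk.
  (* Zeroing the rows before [N] makes the matrix dominated by [G] everywhere. *)
  pose A m n := if (m < N)%N then 0 else coord e m (a (e n)).
  have -> : proj e k z - proj e N z =
      \sum_(0 <= m < k) (\sum_(0 <= n < l) A m n * coord e n x) *: e m.
    apply: (coord_inj he) => m; rewrite coordB // !coord_proj // coord_fsum // /A.
    case: (ltnP m N) => mN.
      by rewrite (leq_trans mN Nk) subrr big1 // => n _; rewrite mul0r.
    case: ifP => _; rewrite subr0 //.
    rewrite /z /proj linear_sum coord_sum //; apply: eq_bigr => n _.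
    by rewrite linearZ coordZ // mulrC.
  apply: (majorant_bound _ _ _ Gp (ltW eta0) Gb) => m n.
  rewrite /A; case: ltnP => mN; last exact: GE.
  by rewrite nrm0 (positive_entry he hu).
have cx : (fun l => nrm (a (proj e l x) - proj e N (a (proj e l x)))) @ \oo -->
    nrm (a x - proj e N (a x)).
  apply: (@lipschitz_cvg _ _ (fun z => nrm (z - proj e N z)) 2).
    exact: nrm_tail_lipschitz.
  exact: (linear_proj_cvg he ca (x := x)).
exact: (@ger_cvg_from _ _ _ _ 0%N cx).
Qed.

Lemma ghost_compact : compact_op a.
Proof.
have [ca _ _] := ha; have [B B0 hB] := bounded_linear ca.
apply: (@precompact_tails _ _ e he hu _ B) => [_ [x /= hx <-]|eta eta0].
  move: hx; rewrite -[1]/(1%:C) ler_nrmE => hx.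
  by apply: le_trans (hB x) _; rewrite ler_piMr.
have [N hN] := ghost_tails eta0; exists N => _ [x /= hx <-].
move: hx; rewrite -[1]/(1%:C) ler_nrmE => hx.
by apply: le_trans (hN x) _; rewrite ler_piMr // ltW.
Qed.

End Ghosts.

Theorem theorem1p6 (R : realType) (d : nat -> nat -> R)
  (E : completeNormedModType R[i]) (e : nat -> E) :
  is_metric d ->
  uniformly_locally_finite d ->
  property_A d ->
  schauder_basis e ->
  one_unconditional e ->
  symmetric_basis e ->
  forall a : {linear E -> E},
    regular_roe e d a -> ghost e a -> compact_op a.
Proof.
by move=> dm dlf hA he hu hs a ha ag; exact: (ghost_compact he hu hs dm dlf hA ha ag).
Qed.
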